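(* Let $\phi$ be a finite-range repulsive pair potential on $\mathbb{R}^d$ and let $\lambda>0$ be such that the family of Gibbs point processes defined by $\phi$ exhibits strong spatial mixing with activities bounded by $\lambda$. Then for every unit vector $\vec u\in\mathbb{S}^{d-1}$, $$p(\lambda)=\rho_{\boldsymbol{\lambda}_{\vec u}}(0),$$ where $\boldsymbol{\lambda}_{\vec u}(x)=\lambda\mathbf 1\{\langle\vec u,x\rangle\ge0\}$.
   Context: Pair potential $\phi$ (symmetric, $\phi\ge 0$, $\phi(x)=0$ for $\|x\|>r$), $H(x_1,\dots,x_k)=\sum_{i<j}\phi(x_i-x_j)$, partition function $Z(\boldsymbol{\lambda})$ and Gibbs measure $\mu_{\boldsymbol{\lambda}}$ for a bounded, boundedly supported activity function $\boldsymbol{\lambda}\ge0$ are as usual: $Z(\boldsymbol{\lambda})=1+\sum_{k\ge1}\frac1{k!}\int\prod_i\boldsymbol{\lambda}(x_i)e^{-H}dx$ and $\mu_{\boldsymbol{\lambda}}$ has density $\prod_i\boldsymbol{\lambda}(x_i)e^{-H}/Z(\boldsymbol{\lambda})$ w.r.t. the unit-intensity Poisson process (with the $1/k!$ convention). Strong spatial mixing with activities bounded by $\lambda$ means: there exist $\alpha,\beta>0$ such that for all bounded measurable $\Lambda$ and activity functions $\boldsymbol{\lambda},\boldsymbol{\lambda}'\le\lambda$, the total variation distance between the laws of $\mu_{\boldsymbol{\lambda}}$ and $\mu_{\boldsymbol{\lambda}'}$ restricted to $\Lambda$ is at most $\alpha|\Lambda|e^{-\beta\,\mathrm{dist}(\Lambda,\supp(\boldsymbol{\lambda}-\boldsymbol{\lambda}'))}$.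 The one-point density is $\rho_{\boldsymbol{\lambda}}(v)=\boldsymbol{\lambda}(v)\mathbb{E}_{\mu_{\boldsymbol{\lambda}}}e^{-H_v(\mathbf X)}$ with $H_v(\mathbf X)=\sum_{x\in\mathbf X}\phi(v-x)$; for $\boldsymbol{\lambda}$ without bounded support, $\rho_{\boldsymbol{\lambda}}(v)=\lim_{n\to\infty}\rho_{\boldsymbol{\lambda}\mathbf 1_{B_n}}(v)$ (which exists under strong spatial mixing), $B_n$ the ball of radius $n$ at the origin. For constant $\lambda$ and bounded $\Lambda$, $Z_\Lambda(\lambda)=Z(\lambda\mathbf 1_\Lambda)$. The pressure is $p(\lambda)=\lim_{n\to\infty}|\Lambda_n|^{-1}\log Z_{\Lambda_n}(\lambda)$ with $\Lambda_n=[-n,n]^d$. *)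

(* Defs.v *)
From HB Require Import structures.
From mathcomp Require Import all_boot all_order all_algebra.
From mathcomp Require Import all_classical all_reals all_analysis.
From mathcomp Require Import measurable_realfun lebesgue_integral.
Set Implicit Arguments. Unset Strict Implicit. Unset Printing Implicit Defensive.
Import Order.TTheory GRing.Theory Num.Theory.
Import numFieldNormedType.Exports.
Local Open Scope classical_set_scope.
Local Open Scope ring_scope.

Section GibbsDefs.
Variables (R : realType) (d : nat).

(* Points of R^d are d-tuples of reals (with the product sigma-algebra of
   mathcomp-analysis on tuples, i.e. the Borel sigma-algebra of R^d). *)
Local Notation pt := (d.-tuple R).

Definition pt0 : pt := [tuple (0 : R) | i < d].
Definition ptsub (x y : pt) : pt := [tuple tnth x i - tnth y i | i < d].
Definition ptopp (x : pt) : pt := [tuple - tnth x i | i < d].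
Definition inner (x y : pt) : R := \sum_(i < d) tnth x i * tnth y i.
Definition enorm (x : pt) : R := Num.sqrt (\sum_(i < d) tnth x i ^+ 2).

(* Lebesgue integral on R^n, as the iterated one-dimensional Lebesgue
   integral (Tonelli: equal to the integral w.r.t. the product measure for
   the nonnegative measurable integrands used below). *)
Fixpoint iint (n : nat) : (n.-tuple R -> \bar R) -> \bar R :=
  match n return (n.-tuple R -> \bar R) -> \bar R with
  | 0 => fun F => F [tuple]
  | m.+1 => fun F =>
      (\int[@lebesgue_measure R]_t iint (fun s : m.-tuple R => F [tuple of t :: s]))%E
  end.

Fixpoint kint (k : nat) (F : seq pt -> \bar R) : \bar R :=
  match k with
  | 0 => F [::]
  | k'.+1 => iint (fun x : pt => kint k' (fun xs => F (x :: xs)))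
  end.

(* integration against the (unnormalised, 1/k! convention) Poisson
   reference measure on finite configurations *)
Definition confint (F : seq pt -> \bar R) : \bar R :=
  (\sum_(0 <= k <oo) ((k`!%:R)^-1)%:E * kint k F)%E.

Definition vol (L : set pt) : R := fine (iint (fun x : pt => (\1_L x)%:E)).

Section Potential.
Variable phi : pt -> \bar R.

Fixpoint Hen (xs : seq pt) : \bar R :=
  match xs with
  | [::] => 0%E
  | x :: ys => (\sum_(y <- ys) phi (ptsub x y) + Hen ys)%E
  end.

Definition Hv (v : pt) (xs : seq pt) : \bar R :=
  (\sum_(y <- xs) phi (ptsub v y))%E.

Definition weight (a : pt -> R) (xs : seq pt) : \bar R :=
  ((\prod_(x <- xs) a x)%:E * expeR (- Hen xs))%E.

Definition Zpart (a : pt -> R) : \bar R := confint (weight a).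

Definition gibbsE (a : pt -> R) (G : seq pt -> \bar R) : R :=
  fine (confint (fun xs => G xs * weight a xs)%E) / fine (Zpart a).

Definition restr (L : set pt) (xs : seq pt) : seq pt :=
  seq.filter (fun x => `[< L x >]) xs.

(* measurable events of the configuration space (finite point sets) *)
Definition config_event (A : set (seq pt)) : Prop :=
  (forall s s' : seq pt, perm_eq s s' -> A s = A s') /\
  (forall k : nat, measurable [set t : k.-tuple pt | A (tval t)]).

Definition tv_restr (a b : pt -> R) (L : set pt) : R :=
  sup [set `| gibbsE a (fun xs => (\1_A (restr L xs))%:E)
            - gibbsE b (fun xs => (\1_A (restr L xs))%:E) |
      | A in config_event].

(* Euclidean distance between two sets (+oo if one is empty) *)
Definition setdist (A B : set pt) : \bar R :=
  ereal_inf [set (enorm (ptsub x y))%:E | x in A & y in B].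

Definition bounded_set (L : set pt) : Prop :=
  exists M : R, forall x, L x -> enorm x <= M.

Definition activity (a : pt -> R) : Prop :=
  measurable_fun setT a /\ (forall x, 0 <= a x) /\ (exists M : R, forall x, a x <= M)
  /\ bounded_set [set x | a x != 0].

Definition strong_spatial_mixing (lam : R) : Prop :=
  exists alpha beta : R, 0 < alpha /\ 0 < beta /\
  forall (L : set pt) (a b : pt -> R),
    measurable L -> bounded_set L ->
    activity a -> activity b ->
    (forall x, a x <= lam) -> (forall x, b x <= lam) ->
    ((tv_restr a b L)%:E <=
       (alpha * vol L)%:E * expeR (- (beta%:E * setdist L [set x | a x != b x])))%E.

(* one-point density rho_a(v) for a boundedly supported activity *)
Definition rho (a : pt -> R) (v : pt) : R :=
  a v * gibbsE a (fun xs => expeR (- Hv v xs)).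

End Potential.

Definition pair_potential (phi : pt -> \bar R) : Prop :=
  measurable_fun setT phi /\ (forall x, phi (ptopp x) = phi x) /\
  (forall x, (0 <= phi x)%E) /\
  (exists r : R, forall x, r < enorm x -> phi x = 0%E).

Definition ballB (n : nat) : set pt := [set x | enorm x <= n%:R].
Definition boxL (n : nat) : set pt := [set x | forall i, `|tnth x i| <= n%:R].

Definition halfspace_act (lam : R) (u : pt) (x : pt) : R :=
  if 0 <= inner u x then lam else 0.

End GibbsDefs.

(* Main.v *)
Require Import Defs.
From HB Require Import structures.
From mathcomp Require Import all_boot all_order all_algebra.
From mathcomp Require Import all_classical all_reals all_analysis.
From mathcomp Require Import measurable_realfun lebesgue_integral.
From mathcomp Require Import ring lra.
Import Order.TTheory GRing.Theory Num.Theory.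
Import numFieldNormedType.Exports.
Local Open Scope classical_set_scope.
Local Open Scope ring_scope.

(* Write [q a v] ([insertion] below) for [E_a exp (- H_v)]. Adding a small
   activity [b] of total mass [m] to [a] changes the partition function by
     Z a + \int b v * Z a * q a v dv <= Z (a + b)
                     <= Z a + \int b v * Z (a + b) * q (a + b) v dv,
   by a first-order expansion of [prod (a + b)] and Mecke's formula; it also
   changes [q] by at most [m]. The box is filled slab by slab, by decreasing
   height in direction [u]. When the slab at height [<u, v>] is added, the
   activity near a point [v] far from the boundary is, up to a thin slab, the
   half-space activity at [v], so strong spatial mixing and translation
   invariance put [q] close to [Q = lim q (lam_u 1_(B_n)) 0]. The logarithmic
   increments of [Z] then sum to [lam * Q * |box|] up to boundary terms. No
   rotation of coordinates is needed, and thin slabs have small mass because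
   their translates along [u] are disjoint. *)

(** * Lebesgue measure on tuples *)

(** Existence of the pressure is part of the conclusion: the box average of [ln Z] is squeezed
    between two bounds that both come within any tolerance of [lam * Q]. The lower increment
    evaluates the insertion probability before a slab is added, the upper one after it; the two
    differ by at most the mass of the slab, and this gap is absorbed in the tolerance. Every error
    is proportional to the mass where it occurs, so the number of slabs does not enter the final
    bound. This dictates the order of choices: the tolerance [h], then the mixing radius [s], which
    fixes the width of the boundary layer, then the box, and only then the number of slabs, which
    must grow with the box. In the boundary layer only the bounds 0 and 1 on the insertion
    probability are available, but its share of the volume vanishes. Two mismatches shape the
    technical part. Integrals are given as iterated ones, whereas Mecke's formula and translations
    call for Tonelli, hence for genuine measures on tuples. Mixing controls probabilities of events,
    whereas an insertion probability is the mean of a function with values in [0, 1], hence the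
    layer-cake argument. *)

Lemma sigma_finite_product {d1 d2} {T1 : measurableType d1}
    {T2 : measurableType d2} {R : realType}
    (m1 : {sigma_finite_measure set T1 -> \bar R})
    (m2 : {sigma_finite_measure set T2 -> \bar R}) :
  sigma_finite setT (m1 \x m2)%E.
Proof.
have [F TF FP] := sigma_finiteT m1; have [G TG GP] := sigma_finiteT m2.
pose pr n : nat * nat := odflt (0, 0)%N (unpickle n).
exists (fun n => F (pr n).1 `*` G (pr n).2) => [|n].
  apply/esym/seteqP; split => // -[x y] _.
  have [i _ Fx] : (\bigcup_i F i) x by rewrite -TF.
  have [j _ Gy] : (\bigcup_j G j) y by rewrite -TG.
  by exists (pickle (i, j)) => //=; rewrite /pr pickleK.
have [mF Foo] := FP (pr n).1; have [mG Goo] := GP (pr n).2.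
split; first exact: measurableX.
by rewrite product_measure1E// lte_mul_pinfty// ge0_fin_numE.
Qed.

Section TupleIntegral.
Context {d} {T : measurableType d} {R : realType}.
Variable mu : {sigma_finite_measure set T -> \bar R}.

(** The recursion of [iint] over an arbitrary measure. It is instantiated twice: at [leb] for
    Lebesgue measure on points, and at [lebd d] for the measure on [k]-point configurations. *)
Fixpoint tint (n : nat) : (n.-tuple T -> \bar R) -> \bar R :=
  match n return (n.-tuple T -> \bar R) -> \bar R with
  | 0 => fun F => F [tuple]
  | m.+1 => fun F =>
      (\int[mu]_x tint m (fun s : m.-tuple T => F [tuple of x :: s]))%E
  end.

Lemma measurable_tcons n :
  measurable_fun setT (fun p : T * n.-tuple T => [tuple of p.1 :: p.2]).
Proof. by apply: measurable_cons. Qed.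

Lemma measurable_thead n :
  measurable_fun setT (fun t : n.+1.-tuple T => thead t).
Proof. exact: measurable_tnth. Qed.

Lemma measurable_cons_tupleP n (F : n.+1.-tuple T -> \bar R) :
  measurable_fun setT (fun p : T * n.-tuple T => F [tuple of p.1 :: p.2]) ->
  measurable_fun setT F.
Proof.
move=> mF.
rewrite (_ : F = (fun p : T * n.-tuple T => F [tuple of p.1 :: p.2]) \o
   (fun t => (thead t, [tuple of behead t]))).
  apply: measurableT_comp => //.
  apply/measurable_fun_pairP; split; [exact: measurable_thead|].
  exact: measurable_behead.
by apply/funext => t /=; rewrite -tuple_eta.
Qed.

Lemma measurable_tcons_pair1 {n} {F : n.+1.-tuple T -> \bar R} (x : T) :
  measurable_fun setT F ->
  measurable_fun setT (fun s : n.-tuple T => F [tuple of x :: s]).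
Proof. by move=> mF; apply: measurableT_comp => //; apply: measurable_cons. Qed.

(** The measure is the pushforward of [mu \x m] along cons. Sigma-finiteness is carried through the
    induction because Tonelli asks for it at the next stage. *)
Lemma tuple_measure_exists n :
  exists m : {sigma_finite_measure set (n.-tuple T) -> \bar R},
  forall F, measurable_fun setT F -> (forall t, 0 <= F t)%E ->
    (\int[m]_t F t)%E = tint n F.
Proof.
elim: n => [|n [m IH]].
  exists (@dirac _ (0.-tuple T) [tuple] R) => F mF F0 /=.
  by rewrite integral_dirac// diracT mul1e.
pose c (p : T * n.-tuple T) : n.+1.-tuple T := [tuple of p.1 :: p.2].
have mc : measurable_fun setT c by exact: measurable_tcons.
pose pm : {measure set (T * n.-tuple T)%type -> \bar R} := (mu \x m)%E.
pose m' := measure_function_pushforward__canonical__measure_function_Measure pm mc.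
have sf : sigma_finite setT m'.
  have [F TF FP] := sigma_finite_product mu m.
  pose e (t : n.+1.-tuple T) := (thead t, [tuple of behead t]).
  have me : measurable_fun setT e.
    apply/measurable_fun_pairP; split; [exact: measurable_thead|].
    exact: measurable_behead.
  have ec p : e (c p) = p.
    by case: p => x t; rewrite /e /c /=; congr pair; apply: val_inj.
  exists (fun k => e @^-1` F k) => [|k].
    by rewrite -preimage_bigcup -TF preimage_setT.
  have [mF Foo] := FP k; split.
    by rewrite -[X in measurable X]setTI; exact: me.
  rewrite [ltLHS](_ : _ = pm (F k))//; congr (pm _).
  by apply/seteqP; split => p /=; rewrite ec.
pose m1 := HB.pack_for {sigma_finite_measure set _ -> \bar R} (Measure.sort m')
  (Measure_isSigmaFinite.Build _ _ _ m' sf).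
exists m1 => F mF F0.
rewrite ge0_integral_pushforward//= fubini_tonelli1//=; last first.
  exact: measurableT_comp.
apply: eq_integral => x _; rewrite /fubini_F -IH//.
exact: measurable_tcons_pair1.
Qed.

Definition tmeas n : {sigma_finite_measure set (n.-tuple T) -> \bar R} :=
  sval (cid (tuple_measure_exists n)).

Lemma tmeasE n (F : n.-tuple T -> \bar R) :
  measurable_fun setT F -> (forall t, 0 <= F t)%E ->
  (\int[tmeas n]_t F t)%E = tint n F.
Proof. exact: (svalP (cid (tuple_measure_exists n))). Qed.

Lemma tmeas0 (F : 0.-tuple T -> \bar R) :
  measurable_fun setT F -> (forall t, 0 <= F t)%E ->
  (\int[tmeas 0]_t F t)%E = F [tuple].
Proof. by move=> mF F0; rewrite tmeasE. Qed.

Lemma tmeasS n (F : n.+1.-tuple T -> \bar R) :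
  measurable_fun setT F -> (forall t, 0 <= F t)%E ->
  (\int[tmeas n.+1]_t F t = \int[mu]_x \int[tmeas n]_s F [tuple of x :: s])%E.
Proof.
move=> mF F0; rewrite tmeasE//=; apply: eq_integral => x _.
by rewrite tmeasE//; exact: measurable_tcons_pair1.
Qed.

Lemma measurable_tmeas {d'} {S : measurableType d'} n
    (F : S * n.-tuple T -> \bar R) :
  measurable_fun setT F -> (forall p, 0 <= F p)%E ->
  measurable_fun setT (fun x => \int[tmeas n]_s F (x, s))%E.
Proof. by move=> mF F0; exact: measurable_fun_fubini_tonelli_F. Qed.

Lemma measurable_tprod n (f : T -> R) : measurable_fun setT f ->
  measurable_fun setT (fun t : n.-tuple T => (\prod_(x <- t) f x)%:E).
Proof.
move=> mf; apply/measurable_EFinP; elim: n => [|k IH].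
  rewrite (_ : (fun _ => _) = cst 1)//.
  by apply/funext => t; rewrite tuple0/= big_nil.
rewrite (_ : (fun _ => _) = (fun t : k.+1.-tuple T =>
   f (thead t) * (\prod_(x <- [tuple of behead t]) f x))).
  apply: measurable_funM.
    by apply: measurableT_comp => //; exact: measurable_thead.
  by apply: (measurableT_comp IH); exact: measurable_behead.
by apply/funext => t; rewrite {1}(tuple_eta t) big_cons.
Qed.

Lemma tmeas_prod n (f : T -> R) (M : R) :
  measurable_fun setT f -> (forall x, 0 <= f x) ->
  (\int[mu]_x (f x)%:E)%E = M%:E ->
  (\int[tmeas n]_t (\prod_(x <- t) f x)%:E)%E = (M ^+ n)%:E.
Proof.
move=> mf f0 fM.
have mp k := measurable_tprod k f mf.
have p0 (t : seq T) : 0 <= \prod_(x <- t) f x by apply: prodr_ge0.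
elim: n => [|n IH].
  rewrite tmeas0; [by rewrite /= big_nil expr0|exact: mp|].
  by move=> t; rewrite lee_fin p0.
rewrite tmeasS; [|exact: mp|by move=> t; rewrite lee_fin p0].
rewrite (eq_integral (fun x => (M ^+ n)%:E * (f x)%:E)%E); last first.
  move=> x _; rewrite -IH muleC -ge0_integralZl//.
  - by apply: eq_integral => t _; rewrite /= big_cons EFinM.
  - exact: mp.
  - by move=> t _; rewrite lee_fin p0.
  - by rewrite lee_fin.
rewrite ge0_integralZl//.
- by rewrite fM -EFinM exprSr.
- exact/measurable_EFinP.
- by move=> x _; rewrite lee_fin.
- rewrite lee_fin exprn_ge0// -lee_fin -fM integral_ge0// => x _.
  by rewrite lee_fin.
Qed.

(** [g] is indexed by the position so that one statement covers translations of R^d, where each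
    coordinate moves by its own amount, and translations of configurations, where all points move
    alike. *)
Lemma tmeas_map n (g : nat -> T -> T) (F : n.-tuple T -> \bar R) :
  (forall i, measurable_fun setT (g i)) ->
  (forall i f, measurable_fun setT f -> (forall x, 0 <= f x)%E ->
     (\int[mu]_x f (g i x) = \int[mu]_x f x)%E) ->
  measurable_fun setT F -> (forall t, 0 <= F t)%E ->
  (\int[tmeas n]_t F [tuple g i (tnth t i) | i < n] = \int[tmeas n]_t F t)%E.
Proof.
elim: n g F => [|n IH] g F mg gI mF F0.
  by apply: eq_integral => t _; rewrite tuple0 (tuple0 t).
have mgt k (h : nat -> T -> T) : (forall i, measurable_fun setT (h i)) ->
    measurable_fun setT (fun t : k.-tuple T => [tuple h i (tnth t i) | i < k]).
  move=> mh; apply/measurable_fun_tnthP => i.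
  rewrite (_ : _ \o _ = (h i) \o (@tnth _ _ ^~ i)).
    by apply: measurableT_comp => //; exact: measurable_tnth.
  by apply/funext => t /=; rewrite tnth_mktuple.
rewrite tmeasS//; last by apply: measurableT_comp => //; exact: mgt.
rewrite tmeasS//.
pose G x := (\int[tmeas n]_s F [tuple of x :: s])%E.
transitivity (\int[mu]_x G (g 0%N x))%E; last first.
  apply: gI; last by move=> x; apply: integral_ge0.
  apply: (measurable_tmeas n (fun p : T * n.-tuple T => F [tuple of p.1 :: p.2])) => //.
  by apply: measurableT_comp => //; exact: measurable_tcons.
apply: eq_integral => x _.
rewrite /G -(IH (fun i => g i.+1) (fun s => F [tuple of g 0%N x :: s])).
- apply: eq_integral => s _; congr F; apply: eq_from_tnth => i.
  rewrite tnth_mktuple; case: (unliftP ord0 i) => [j|] ->.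
    by rewrite !tnthS tnth_mktuple.
  by rewrite !tnth0.
- by move=> i; exact: mg.
- by move=> i f; exact: gI.
- exact: measurable_tcons_pair1.
- by move=> s; exact: F0.
Qed.

End TupleIntegral.

Section LebesgueMeasure.
Context {R : realType}.

Lemma measurable_id_lebesgue :
  measurable_fun [set: measurableTypeR R] (id : measurableTypeR R -> R).
Proof. by move=> _ A mA; rewrite setTI. Qed.

(* Lebesgue measure over the default measurable structure of [R], the one used
   by tuples; the library only provides it over [measurableTypeR R]. *)
Lemma lebesgue_default_exists :
  exists m : {sigma_finite_measure set R -> \bar R},
  (forall A, measurable A -> m A = @lebesgue_measure R A) /\
  forall F : R -> \bar R, measurable_fun setT F -> (forall t, 0 <= F t)%E ->
    (\int[m]_t F t = \int[@lebesgue_measure R]_t F t)%E.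
Proof.
pose m' := measure_function_pushforward__canonical__measure_function_Measure
  (@lebesgue_measure R) measurable_id_lebesgue.
have sf : sigma_finite setT m' by exact: (sigma_finiteT (@lebesgue_measure R)).
pose m1 := HB.pack_for {sigma_finite_measure set _ -> \bar R} (Measure.sort m')
  (Measure_isSigmaFinite.Build _ _ _ m' sf).
exists m1; split => // F mF F0.
by rewrite ge0_integral_pushforward//; exact: measurable_id_lebesgue.
Qed.

Definition leb : {sigma_finite_measure set R -> \bar R} :=
  sval (cid lebesgue_default_exists).

Lemma lebE A : measurable A -> leb A = @lebesgue_measure R A.
Proof. exact: (svalP (cid lebesgue_default_exists)).1. Qed.

Lemma integral_leb (F : R -> \bar R) :
  measurable_fun setT F -> (forall t, 0 <= F t)%E ->
  (\int[leb]_t F t = \int[@lebesgue_measure R]_t F t)%E.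
Proof. exact: (svalP (cid lebesgue_default_exists)).2. Qed.

Lemma integral_lebesgue_shift (c : R) (f : R -> \bar R) :
  measurable_fun setT f -> (forall x, 0 <= f x)%E ->
  (\int[leb]_x f (x + c)%R = \int[leb]_x f x)%E.
Proof.
move=> mf f0.
pose sh (x : R) : R := x + c.
have ms : measurable_fun [set: R] sh.
  by apply: measurable_funD.
transitivity (\int[pushforward leb sh]_x f x)%E.
  by rewrite ge0_integral_pushforward// preimage_setT.
pose m' := measure_function_pushforward__canonical__measure_function_Measure leb ms.
suff E A : measurable A -> leb A = m' A.
  by apply: eq_measure_integral => A mA _; rewrite /= -E.
move=> mA; rewrite lebE//.
have ms' : measurable_fun [set: measurableTypeR R]  (sh : _ -> measurableTypeR R).
  exact: ms.
pose m2 := measure_function_pushforward__canonical__measure_function_Measure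
  (@lebesgue_measure R) ms'.
rewrite (_ : m' A = m2 A); last first.
  by rewrite /= /pushforward lebE// -[X in measurable X]setTI; exact: (ms).
(* Uniqueness of Lebesgue measure reduces invariance to half-open intervals. *)
apply: (@lebesgue_measure_unique R m2) => // X [[a b]/= _ <-].
rewrite /pushforward (_ : _ @^-1` _ = `]a - c, b - c]%classic).
  rewrite !lebesgue_measure_itv/= !lte_fin ltrD2r.
  by case: ifPn => // _; rewrite -!EFinB; congr EFin; rewrite opprB addrA subrK.
by apply/seteqP; split => x /=; rewrite !in_itv/= ltrBlDr lerBrDr.
Qed.

End LebesgueMeasure.

Section LebesgueTuple.
Context {R : realType}.

Definition lebd d : {sigma_finite_measure set (d.-tuple R) -> \bar R} :=
  tmeas (@leb R) d.

Lemma iintE d (F : d.-tuple R -> \bar R) :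
  measurable_fun setT F -> (forall x, 0 <= F x)%E ->
  iint F = (\int[lebd d]_x F x)%E.
Proof.
elim: d F => [|d IH] F mF F0.
  by rewrite tmeas0.
rewrite tmeasS//= integral_leb.
- apply: eq_integral => x _; apply: IH => //.
  exact: measurable_tcons_pair1.
- apply: (measurable_tmeas _ d (fun p : R * d.-tuple R => F [tuple of p.1 :: p.2])) => //.
  by apply: measurableT_comp => //; exact: measurable_tcons.
- by move=> x; apply: integral_ge0.
Qed.

Definition ptadd d (x v : d.-tuple R) : d.-tuple R :=
  [tuple tnth x i + tnth v i | i < d].

Lemma lebd_shift d (v : d.-tuple R) (F : d.-tuple R -> \bar R) :
  measurable_fun setT F -> (forall x, 0 <= F x)%E ->
  (\int[lebd d]_x F (ptadd d x v) = \int[lebd d]_x F x)%E.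
Proof.
move=> mF F0.
pose g (i : nat) (x : R) := x + nth 0 v i.
rewrite -[RHS](tmeas_map _ d g)//.
- apply: eq_integral => x _; congr F; apply: eq_from_tnth => i.
  by rewrite !tnth_mktuple /g (tnth_nth 0 v).
- by move=> i; apply: measurable_funD.
- by move=> i f mf f0; exact: integral_lebesgue_shift.
Qed.

Lemma kintE d k (F : seq (d.-tuple R) -> \bar R) :
  (forall n, measurable_fun setT (fun t : n.-tuple (d.-tuple R) => F t)) ->
  (forall s, 0 <= F s)%E ->
  kint k F = (\int[tmeas (lebd d) k]_t F t)%E.
Proof.
elim: k F => [|k IH] F mF F0; first by rewrite tmeas0.
have mFx x n : measurable_fun setT (fun t : n.-tuple (d.-tuple R) => F (x :: t)).
  exact: (measurable_tcons_pair1 (F := fun t : n.+1.-tuple _ => F t)).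
rewrite tmeasS//=.
under eq_fun do rewrite IH//.
rewrite iintE//; last by move=> x; exact: integral_ge0.
apply: (measurable_tmeas _ k (fun p : d.-tuple R * k.-tuple _ => F (p.1 :: p.2))) => //.
apply: (measurableT_comp (mF k.+1)); exact: measurable_tcons.
Qed.

End LebesgueTuple.

(** * Measurability on configurations and Mecke's formula *)

Lemma measurable_expeR {R : realType} : measurable_fun [set: \bar R] (@expeR R).
Proof.
rewrite (_ : @expeR R = fun x => if x == -oo%E then 0%E else
   if x == +oo%E then +oo%E else (expR (fine x))%:E); last first.
  by apply/funext; case.
apply: measurable_fun_ifT => //=; first exact: measurable_fun_eqe.
apply: measurable_fun_ifT => //=; first exact: measurable_fun_eqe.
by apply/measurable_EFinP => //=; exact: (@measurableT_comp _ _ _ _ _ _ expR).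
Qed.

Section ConfigurationMeasurability.
Context {R : realType} {d : nat}.
Notation pt := (d.-tuple R).
Implicit Types (F G : seq pt -> \bar R) (a b c : pt -> R).

(** Measurability is asked on each layer of [n]-point configurations separately, matching the way
    [confint] integrates and [config_event] is stated. *)
Definition conf_measurable F :=
  forall n, measurable_fun setT (fun t : n.-tuple pt => F t).

Lemma conf_measurable_pair {F} n : conf_measurable F ->
  measurable_fun setT (fun p : pt * n.-tuple pt => F (p.1 :: p.2)).
Proof.
by move=> mF; apply: (measurableT_comp (mF n.+1)); exact: measurable_tcons.
Qed.

Lemma conf_measurable_consl {F} x : conf_measurable F ->
  conf_measurable (fun s => F (x :: s)).
Proof.
move=> mF n; exact: (measurable_tcons_pair1 (F := fun t : n.+1.-tuple _ => F t)).
Qed.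

Lemma conf_measurableM F G : conf_measurable F -> conf_measurable G ->
  conf_measurable (fun s => F s * G s)%E.
Proof. by move=> mF mG n; apply: emeasurable_funM; [exact: mF|exact: mG]. Qed.

Lemma conf_measurableD F G : conf_measurable F -> conf_measurable G ->
  conf_measurable (fun s => F s + G s)%E.
Proof. by move=> mF mG n; apply: emeasurable_funD; [exact: mF|exact: mG]. Qed.

Lemma conf_measurable_prod a : measurable_fun setT a ->
  conf_measurable (fun s => (\prod_(y <- s) a y)%:E).
Proof. by move=> ma n; exact: measurable_tprod. Qed.

(* sum over the choice of one point, which carries activity [b] while all
   others carry activity [c] *)
Fixpoint pointed_prod b c (s : seq pt) : R :=
  if s is x :: s' then
    b x * \prod_(y <- s') c y + c x * pointed_prod b c s'
  else 0.

Lemma conf_measurable_pointed b c :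
  measurable_fun setT b -> measurable_fun setT c ->
  conf_measurable (fun s => (pointed_prod b c s)%:E).
Proof.
move=> mb mc n; apply/measurable_EFinP; elim: n => [|n IH].
  rewrite (_ : (fun _ => _) = cst 0)//.
  by apply/funext => t; rewrite tuple0.
have mp := conf_measurable_prod c mc n.
rewrite (_ : (fun _ => _) = (fun t : n.+1.-tuple pt =>
    b (thead t) * (\prod_(x <- [tuple of behead t]) c x) +
    c (thead t) * pointed_prod b c [tuple of behead t])).
  apply: measurable_funD; apply: measurable_funM.
  - by apply: measurableT_comp => //; exact: measurable_thead.
  - move/measurable_EFinP in mp; apply: (measurableT_comp mp); exact: measurable_behead.
  - by apply: measurableT_comp => //; exact: measurable_thead.
  - by apply: (measurableT_comp IH); exact: measurable_behead.
by apply/funext => t; rewrite {1}(tuple_eta t).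
Qed.

Lemma pointed_prod_ge0 b c : (forall x, 0 <= b x) -> (forall x, 0 <= c x) ->
  forall s, 0 <= pointed_prod b c s.
Proof.
move=> b0 c0; elim=> [//|x s IH] /=.
by rewrite addr_ge0// mulr_ge0//; apply: prodr_ge0.
Qed.

(** The left side collects the terms of degree 0 and 1 in [b]; those of higher degree are
    nonnegative. *)
Lemma prod_add_lower a b : (forall x, 0 <= a x) -> (forall x, 0 <= b x) ->
  forall s, \prod_(y <- s) a y + pointed_prod b a s <= \prod_(y <- s) (a y + b y).
Proof.
move=> a0 b0; elim=> [|x s IH] /=; first by rewrite !big_nil addr0.
rewrite !big_cons mulrDl [leLHS]addrCA [leRHS]addrC -mulrDr lerD//.
  by rewrite ler_wpM2l//; apply: ler_prod => y _; rewrite a0 lerDl b0.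
by rewrite ler_wpM2l.
Qed.

(** Group the expansion by the first point that carries [b]: earlier points carry [a], later ones
    [a + b]. Raising [a] to [a + b] at the earlier points yields the pointed product. *)
Lemma prod_add_upper a b : (forall x, 0 <= a x) -> (forall x, 0 <= b x) ->
  forall s, \prod_(y <- s) (a y + b y) <=
    \prod_(y <- s) a y + pointed_prod b (fun x => a x + b x) s.
Proof.
move=> a0 b0; elim=> [|x s IH] /=; first by rewrite !big_nil addr0.
rewrite !big_cons mulrDl [leRHS]addrCA [leLHS]addrC lerD2l.
apply: (@le_trans _ _ (a x * (\prod_(j <- s) a j +
  pointed_prod b (fun x0 => a x0 + b x0) s))); first by rewrite ler_wpM2l.
rewrite mulrDr lerD2l ler_wpM2r ?lerDl//.
by apply: pointed_prod_ge0 => // y; rewrite addr_ge0.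
Qed.

End ConfigurationMeasurability.

Section Energy.
Context {R : realType} {d : nat}.
Notation pt := (d.-tuple R).
Variable phi : pt -> \bar R.
Hypothesis mphi : measurable_fun setT phi.
Hypothesis phi0 : forall x, (0 <= phi x)%E.

Lemma measurable_ptsub {d'} {T : measurableType d'} (f g : T -> pt) :
  measurable_fun setT f -> measurable_fun setT g ->
  measurable_fun setT (fun x => ptsub (f x) (g x)).
Proof.
move=> mf mg; apply/measurable_fun_tnthP => i.
rewrite (_ : _ \o _ = fun x => tnth (f x) i - tnth (g x) i); last first.
  by apply/funext => x /=; rewrite tnth_mktuple.
by apply: measurable_funB;
  apply: (measurableT_comp (f := fun x : pt => tnth x i)) => //;
  exact: measurable_tnth.
Qed.

Lemma measurable_Hv n :
  measurable_fun setT (fun p : pt * n.-tuple pt => Hv phi p.1 p.2).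
Proof.
rewrite (_ : (fun _ => _) = (fun p : pt * n.-tuple pt =>
  \sum_(i < n) phi (ptsub p.1 (tnth p.2 i)))%E); last first.
  by apply/funext => p; rewrite /Hv big_tuple.
apply: emeasurable_sum => i; apply: (measurableT_comp mphi).
apply: measurable_ptsub => //.
by apply: (measurableT_comp (measurable_tnth i)).
Qed.

Lemma conf_measurable_Hen : conf_measurable (Hen phi).
Proof.
elim=> [|n IH].
  rewrite (_ : (fun _ => _) = cst 0%E); first exact: measurable_cst.
  by apply/funext => t; rewrite tuple0.
apply: measurable_cons_tupleP; apply: emeasurable_funD; first exact: measurable_Hv.
by apply: (measurableT_comp IH).
Qed.

Lemma Hv_ge0 v s : (0 <= Hv phi v s)%E.
Proof. exact: sume_ge0. Qed.

Lemma Hen_ge0 s : (0 <= Hen phi s)%E.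
Proof. by elim: s => [//|x s IH] /=; rewrite adde_ge0// sume_ge0. Qed.

Lemma conf_measurable_expNH : conf_measurable (fun s => expeR (- Hen phi s)).
Proof.
move=> n; apply: (measurableT_comp measurable_expeR).
apply: (measurableT_comp (@oppe_measurable R setT)); exact: conf_measurable_Hen.
Qed.

Lemma conf_measurable_weight a : measurable_fun setT a ->
  conf_measurable (weight phi a).
Proof.
move=> ma; apply: conf_measurableM; first exact: conf_measurable_prod.
exact: conf_measurable_expNH.
Qed.

Lemma weight_ge0 a s : (forall x, 0 <= a x) -> (0 <= weight phi a s)%E.
Proof.
by move=> a0; rewrite mule_ge0 ?expeR_ge0// lee_fin prodr_ge0.
Qed.

Lemma expeRN_le1 (x : \bar R) : (0 <= x -> expeR (- x) <= 1)%E.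
Proof. by move=> x0; rewrite -expeR0 lee_expeR leeNl oppe0. Qed.

End Energy.

Section Mecke.
Context {R : realType} {d : nat}.
Notation pt := (d.-tuple R).
Notation mu := (@lebd R d).
Notation km k := (tmeas (@lebd R d) k).
Variables (b c : pt -> R).
Hypotheses (mb : measurable_fun setT b) (mc : measurable_fun setT c).
Hypotheses (b0 : forall x, 0 <= b x) (c0 : forall x, 0 <= c x).

Let cprod (s : seq pt) : \bar R := (\prod_(y <- s) c y)%:E.

Let cprod0 s : (0 <= cprod s)%E.
Proof. by rewrite lee_fin prodr_ge0. Qed.

Let cprod_cons x s : cprod (x :: s) = ((c x)%:E * cprod s)%E.
Proof. by rewrite /cprod big_cons EFinM. Qed.

Let mcprod n : measurable_fun setT (fun t : n.-tuple pt => cprod t).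
Proof. exact: conf_measurable_prod. Qed.

Lemma measurable_kernel_pair {d'} {T : measurableType d'} k
    (W : T -> seq pt -> \bar R) :
  measurable_fun setT (fun p : T * k.-tuple pt => W p.1 p.2) ->
  (forall x s, 0 <= W x s)%E ->
  measurable_fun setT (fun x => \int[km k]_t (cprod t * W x t))%E.
Proof.
move=> mW W0.
apply: (measurable_tmeas _ k (fun p : T * k.-tuple pt => cprod p.2 * W p.1 p.2)%E).
  by apply: emeasurable_funM => //; apply: (measurableT_comp (mcprod k)).
by move=> p; exact: mule_ge0.
Qed.

(** Either the first point of the tuple is the distinguished one, or it is ordinary and the
    distinguished one is still to be chosen among the others. *)
Lemma integral_pointed_prod_rec k (W : seq pt -> \bar R) :
  conf_measurable W -> (forall s, 0 <= W s)%E ->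
  (\int[km k.+1]_t ((pointed_prod b c t)%:E * W t) =
   \int[mu]_x ((b x)%:E * \int[km k]_t (cprod t * W (x :: t))) +
   \int[mu]_x ((c x)%:E * \int[km k]_t ((pointed_prod b c t)%:E * W (x :: t))))%E.
Proof.
move=> mW W0.
have D0 s : (0 <= (pointed_prod b c s)%:E)%E by rewrite lee_fin pointed_prod_ge0.
have mD := conf_measurable_pointed b c mb mc.
rewrite tmeasS; last 2 first.
- by apply: emeasurable_funM; [exact: mD|exact: mW].
- by move=> t; rewrite mule_ge0.
rewrite -ge0_integralD//; last 4 first.
- by move=> x _; rewrite mule_ge0// ?lee_fin// integral_ge0// => t _; rewrite mule_ge0.
- apply: emeasurable_funM; first exact/measurable_EFinP.
  apply: (measurable_kernel_pair k (fun x s => W (x :: s))) => //.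
  exact: conf_measurable_pair.
- by move=> x _; rewrite mule_ge0// ?lee_fin// integral_ge0// => t _; rewrite mule_ge0.
- apply: emeasurable_funM; first exact/measurable_EFinP.
  apply: (measurable_tmeas _ k (fun p : pt * k.-tuple pt =>
    (pointed_prod b c p.2)%:E * W (p.1 :: p.2))%E); last first.
    by move=> p; rewrite mule_ge0.
  apply: emeasurable_funM; last exact: conf_measurable_pair.
  exact: (measurableT_comp (mD k) measurable_snd).
apply: eq_integral => x _.
have mWx := conf_measurable_consl x mW k.
have mPW : measurable_fun setT (fun t : k.-tuple pt => cprod t * W (x :: t))%E.
  by apply: emeasurable_funM; [exact: mcprod|exact: mWx].
have mDW : measurable_fun setT (fun t : k.-tuple pt =>
    (pointed_prod b c t)%:E * W (x :: t))%E.
  by apply: emeasurable_funM; [exact: mD|exact: mWx].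
rewrite -!ge0_integralZl//; last 4 first.
- by move=> t _; rewrite mule_ge0.
- by rewrite lee_fin.
- by move=> t _; rewrite mule_ge0.
- by rewrite lee_fin.
rewrite -ge0_integralD//; last 4 first.
- by move=> t _; rewrite !mule_ge0// lee_fin.
- exact: measurable_funeM.
- by move=> t _; rewrite !mule_ge0// lee_fin.
- exact: measurable_funeM.
apply: eq_integral => t _ /=.
rewrite EFinD !EFinM ge0_muleDl ?muleA//.
- by rewrite mule_ge0// lee_fin ?b0// prodr_ge0.
- by rewrite mule_ge0// lee_fin.
Qed.

(* multivariate Mecke formula, restricted to one distinguished point *)
Lemma mecke k (W : seq pt -> \bar R) :
  conf_measurable W -> (forall s, 0 <= W s)%E ->
  (forall p x y s, W (p ++ x :: y :: s) = W (p ++ y :: x :: s)) ->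
  (\int[km k.+1]_t ((pointed_prod b c t)%:E * W t) =
   k.+1%:R%:E *
   \int[mu]_v ((b v)%:E * \int[km k]_t (cprod t * W (v :: t))))%E.
Proof.
elim: k W => [|k IH] W mW W0 Wsym; rewrite integral_pointed_prod_rec//.
  rewrite mul1e [X in (_ + X)%E](_ : _ = 0%E) ?adde0//.
  apply: integral0_eq => x _.
  rewrite tmeas0 /= ?mul0e ?mule0//.
  - apply: emeasurable_funM; last exact: conf_measurable_consl.
    exact: conf_measurable_pointed.
  - by move=> t; rewrite mule_ge0// lee_fin pointed_prod_ge0.
pose I v := (\int[km k.+1]_t (cprod t * W (v :: t)))%E.
pose J x v := (\int[km k]_t (cprod t * W (x :: v :: t)))%E.
have J0 x v : (0 <= J x v)%E by apply: integral_ge0 => t _; rewrite mule_ge0.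
have I0 v : (0 <= I v)%E by apply: integral_ge0 => t _; rewrite mule_ge0.
have mJ : measurable_fun setT (fun p : pt * pt => J p.1 p.2).
  apply: (measurable_kernel_pair k (fun (p : pt * pt) s => W (p.1 :: p.2 :: s))) => //.
  apply: (measurableT_comp (conf_measurable_pair k.+1 mW)
    (g := fun p : (pt * pt) * k.-tuple pt => (p.1.1, [tuple of p.1.2 :: p.2]))).
  apply/measurable_fun_pairP; split => /=.
    exact: (measurableT_comp measurable_fst measurable_fst).
  apply: measurable_cons => //; exact: (measurableT_comp measurable_snd measurable_fst).
have mI : measurable_fun setT I.
  apply: (measurable_kernel_pair k.+1 (fun x s => W (x :: s))) => //.
  exact: conf_measurable_pair.
have IE v : I v = (\int[mu]_x ((c x)%:E * J x v))%E.
  rewrite /I tmeasS.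
  - apply: eq_integral => x _; rewrite -ge0_integralZl//.
    + apply: eq_integral => t _; rewrite cprod_cons muleA.
      by rewrite (Wsym [::]).
    + apply: emeasurable_funM; first exact: mcprod.
      exact: (conf_measurable_consl v (conf_measurable_consl x mW) k).
    + by move=> t _; rewrite mule_ge0.
    + by rewrite lee_fin.
  - apply: emeasurable_funM; first exact: mcprod.
    exact: conf_measurable_consl.
  - by move=> t; rewrite mule_ge0.
(* Tonelli takes the distinguished point [v] out of the integral over the ordinary point [x]; in
   [IE], symmetry of [W] has let [x] and [v] change places. *)
have swap : (\int[mu]_x ((c x)%:E * \int[mu]_v ((b v)%:E * J x v)) =
    \int[mu]_v ((b v)%:E * I v))%E.
  transitivity (\int[mu]_x \int[mu]_v ((c x)%:E * ((b v)%:E * J x v)))%E.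
    apply: eq_integral => x _; rewrite ge0_integralZl//.
    + apply: emeasurable_funM; first exact/measurable_EFinP.
      exact: (measurableT_comp mJ (measurable_pair1 x)).
    + by move=> v _; rewrite mule_ge0// lee_fin.
    + by rewrite lee_fin.
  rewrite (fubini_tonelli (fun p : pt * pt => (c p.1)%:E * ((b p.2)%:E * J p.1 p.2))%E).
  - apply: eq_integral => v _; rewrite IE -ge0_integralZl//.
    + by apply: eq_integral => x _; rewrite muleCA.
    + apply: emeasurable_funM; first exact/measurable_EFinP.
      exact: (measurableT_comp mJ (measurable_pair2 v)).
    + by move=> x _; rewrite mule_ge0// lee_fin.
    + by rewrite lee_fin.
  - apply: emeasurable_funM.
      by apply/measurable_EFinP; exact: (measurableT_comp mc measurable_fst).
    apply: emeasurable_funM => //.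
    by apply/measurable_EFinP; exact: (measurableT_comp mb measurable_snd).
  - by move=> p; rewrite !mule_ge0// lee_fin.
(* The induction hypothesis with [x] frozen gives [k.+1] copies; the case of a distinguished first
   point supplies the last one. *)
have -> : (\int[mu]_x ((c x)%:E * \int[km k.+1]_t ((pointed_prod b c t)%:E * W (x :: t))) =
    k.+1%:R%:E * \int[mu]_v ((b v)%:E * I v))%E.
  rewrite -swap -[RHS]ge0_integralZl; last first.
  - by rewrite lee_fin.
  - move=> x _; rewrite mule_ge0// ?lee_fin// integral_ge0// => v _.
    by rewrite mule_ge0// lee_fin.
  - apply: emeasurable_funM; first exact/measurable_EFinP.
    apply: (measurable_fun_fubini_tonelli_F (fun p : pt * pt => (b p.2)%:E * J p.1 p.2)%E).
      apply: emeasurable_funM => //.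
      by apply/measurable_EFinP; exact: (measurableT_comp mb measurable_snd).
    by move=> p; rewrite mule_ge0// lee_fin.
  - exact: measurableT.
  - apply: eq_integral => x _; rewrite (IH (fun s => W (x :: s)))//.
    + by rewrite muleCA.
    + exact: conf_measurable_consl.
    + by move=> p y z s; exact: (Wsym (x :: p)).
by rewrite -{1}[X in (X + _)%E]mul1e -ge0_muleDl ?lee_fin.
Qed.

End Mecke.

(** * Integration over finite configurations *)

Section Monotony.
Context {R : realType}.

(* Unlike [ge0_le_integral], no measurability is required: the integral of a
   nonnegative function is a supremum over simple functions. *)
Lemma le_integral_ge0 {d} {T : measurableType d}
    (mu : {measure set T -> \bar R}) (f g : T -> \bar R) :
  (forall x, 0 <= f x)%E -> (forall x, f x <= g x)%E ->
  (\int[mu]_x f x <= \int[mu]_x g x)%E.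
Proof.
move=> f0 fg; have g0 x : (0 <= g x)%E by exact: le_trans (fg x).
rewrite !ge0_integralTE//; apply: le_ereal_sup => _ [h hf <-].
by exists h => // x; exact: le_trans (fg x).
Qed.

Lemma iint_ge0 n (F : n.-tuple R -> \bar R) : (forall t, 0 <= F t)%E ->
  (0 <= iint F)%E.
Proof. by elim: n F => [|n IH] F F0 //=; apply: integral_ge0 => x _; exact: IH. Qed.

Lemma le_iint n (F G : n.-tuple R -> \bar R) : (forall t, 0 <= F t)%E ->
  (forall t, F t <= G t)%E -> (iint F <= iint G)%E.
Proof.
elim: n F G => [|n IH] F G F0 FG //=; apply: le_integral_ge0 => x.
  exact: iint_ge0.
exact: IH.
Qed.

Context {d : nat}.
Implicit Types F G : seq (d.-tuple R) -> \bar R.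

Lemma kint_ge0 k F : (forall s, 0 <= F s)%E -> (0 <= kint k F)%E.
Proof. by elim: k F => [|k IH] F F0 //=; apply: iint_ge0 => x; exact: IH. Qed.

Lemma le_kint k F G : (forall s, 0 <= F s)%E -> (forall s, F s <= G s)%E ->
  (kint k F <= kint k G)%E.
Proof.
elim: k F G => [|k IH] F G F0 FG //=; apply: le_iint => x; last exact: IH.
exact: kint_ge0.
Qed.

Lemma confint_ge0 F : (forall s, 0 <= F s)%E -> (0 <= confint F)%E.
Proof.
by move=> F0; apply: nneseries_ge0 => k _ _; rewrite mule_ge0 ?kint_ge0// lee_fin.
Qed.

Lemma le_confint F G : (forall s, 0 <= F s)%E -> (forall s, F s <= G s)%E ->
  (confint F <= confint G)%E.
Proof.
move=> F0 FG; apply: lee_nneseries => k _.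
  by rewrite mule_ge0 ?kint_ge0// lee_fin.
by rewrite lee_wpmul2l ?lee_fin// le_kint.
Qed.

End Monotony.

Section ConfigurationIntegral.
Context {R : realType} {d : nat}.
Notation pt := (d.-tuple R).
Notation mu := (@lebd R d).
Notation km k := (tmeas (@lebd R d) k).
Implicit Types (F G : seq pt -> \bar R).

Lemma confintE F : conf_measurable F -> (forall s, 0 <= F s)%E ->
  confint F = (\sum_(0 <= k <oo) ((k`!%:R)^-1)%:E * \int[km k]_t F t)%E.
Proof.
move=> mF F0; rewrite /confint; congr (limn _); apply/funext => n.
by apply: eq_bigr => k _; rewrite kintE.
Qed.

Lemma confintD F G : conf_measurable F -> conf_measurable G ->
  (forall s, 0 <= F s)%E -> (forall s, 0 <= G s)%E ->
  confint (fun s => F s + G s)%E = (confint F + confint G)%E.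
Proof.
move=> mF mG F0 G0; rewrite !confintE//; last 2 first.
- exact: conf_measurableD.
- by move=> s; rewrite adde_ge0.
rewrite -nneseriesD; last 2 first.
- by move=> k _ _; rewrite mule_ge0// integral_ge0.
- by move=> k _ _; rewrite mule_ge0// integral_ge0.
congr (limn _); apply/funext => n; apply: eq_bigr => k _.
rewrite ge0_integralD//; [|exact: mF|exact: mG].
by rewrite ge0_muleDr// integral_ge0.
Qed.

Lemma confintZl (r : R) F : 0 <= r -> conf_measurable F ->
  (forall s, 0 <= F s)%E ->
  confint (fun s => r%:E * F s)%E = (r%:E * confint F)%E.
Proof.
move=> r0 mF F0; rewrite !confintE//; last 2 first.
- by move=> n; apply: measurable_funeM; exact: mF.
- by move=> s; rewrite mule_ge0// ?lee_fin.
rewrite -nneseriesZl; last by move=> k _; rewrite mule_ge0// integral_ge0.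
congr (limn _); apply/funext => n; apply: eq_bigr => k _.
rewrite ge0_integralZl//; [by rewrite muleCA|exact: mF].
Qed.

Lemma confint_sum (I : Type) (r : seq I) (F : I -> seq pt -> \bar R) :
  (forall i, conf_measurable (F i)) -> (forall i s, 0 <= F i s)%E ->
  confint (fun s => \sum_(i <- r) F i s)%E = (\sum_(i <- r) confint (F i))%E.
Proof.
move=> mF F0; elim: r => [|i r IH].
  rewrite big_nil.
  rewrite (_ : (fun _ => _) = (fun s => 0%:E * 1)%E); last first.
    by apply/funext => s; rewrite big_nil mul0e.
  rewrite confintZl ?mul0e// => n; exact: measurable_cst.
under eq_fun do rewrite big_cons.
rewrite confintD ?IH ?big_cons// => [n|s]; last exact: sume_ge0.
by apply: emeasurable_sum => j; exact: mF.
Qed.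

Lemma measurable_confint {d'} {T : measurableType d'} (F : T -> seq pt -> \bar R) :
  (forall n, measurable_fun setT (fun p : T * n.-tuple pt => F p.1 p.2)) ->
  (forall x s, 0 <= F x s)%E ->
  measurable_fun setT (fun x => confint (F x)).
Proof.
move=> mF F0.
have mFx x : conf_measurable (F x).
  by move=> n; exact: (measurableT_comp (mF n) (measurable_pair1 x)).
rewrite (_ : (fun x => _) = (fun x =>
    \sum_(0 <= k <oo | k \in predT) (((k`!%:R)^-1)%:E * \int[km k]_t F x t))%E); last first.
  by apply/funext => x; rewrite confintE.
apply: ge0_emeasurable_sum => [k x _ _|k _].
  by rewrite mule_ge0// integral_ge0.
apply: measurable_funeM.
by apply: (measurable_tmeas _ k (fun p : T * k.-tuple pt => F p.1 p.2)).
Qed.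

(** Mecke's formula in each layer: [1/(k+1)!] times the [k+1] choices is [1/k!], so the layer of
    [k+1] points becomes the layer of [k] points seen from [v]. The empty layer vanishes, having no
    point to distinguish. *)
Lemma confint_pointed (b c : pt -> R) (W : seq pt -> \bar R) :
  measurable_fun setT b -> measurable_fun setT c ->
  (forall x, 0 <= b x) -> (forall x, 0 <= c x) ->
  conf_measurable W -> (forall s, 0 <= W s)%E ->
  (forall p x y s, W (p ++ x :: y :: s) = W (p ++ y :: x :: s)) ->
  confint (fun s => (pointed_prod b c s)%:E * W s)%E =
  (\int[mu]_v ((b v)%:E * confint (fun s => (\prod_(y <- s) c y)%:E * W (v :: s))))%E.
Proof.
move=> mb mc b0 c0 mW W0 Wsym.
pose cprod s : \bar R := (\prod_(y <- s) c y)%:E.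
have cprod0 s : (0 <= cprod s)%E by rewrite lee_fin prodr_ge0.
have mcprod : conf_measurable cprod by exact: conf_measurable_prod.
have D0 s : (0 <= (pointed_prod b c s)%:E)%E by rewrite lee_fin pointed_prod_ge0.
have mD := conf_measurable_pointed b c mb mc.
pose I k v := (\int[km k]_t (cprod t * W (v :: t)))%E.
have I0 k v : (0 <= I k v)%E by apply: integral_ge0 => t _; rewrite mule_ge0.
have mI k : measurable_fun setT (I k).
  apply: (measurable_tmeas _ k (fun p : pt * k.-tuple pt => cprod p.2 * W (p.1 :: p.2))%E).
    apply: emeasurable_funM; last exact: conf_measurable_pair.
    exact: (measurableT_comp (mcprod k) measurable_snd).
  by move=> p; rewrite mule_ge0.
rewrite confintE; last 2 first.
- exact: conf_measurableM.
- by move=> s; rewrite mule_ge0.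
rewrite nneseries_recl//; last first.
  by move=> k _; rewrite mule_ge0// integral_ge0// => t _; rewrite mule_ge0.
rewrite tmeas0; last 2 first.
- exact: (conf_measurableM _ _ mD mW 0).
- by move=> t; rewrite mule_ge0.
rewrite /= mul0e mule0 add0e -(nneseries_addn (f := fun k =>
  (((k`!%:R)^-1)%:E * \int[km k]_t ((pointed_prod b c t)%:E * W t))%E)); last first.
  by move=> k; rewrite mule_ge0// integral_ge0// => t _; rewrite mule_ge0.
transitivity (\sum_(0 <= k <oo) \int[mu]_v ((b v)%:E * (((k`!%:R)^-1)%:E * I k v)))%E.
  congr (limn _); apply/funext => n; apply: eq_bigr => k _.
  rewrite addn1 mecke// muleA -EFinM.
  have -> : ((k.+1)`!%:R : R)^-1 * k.+1%:R = (k`!%:R)^-1.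
    by rewrite factS natrM invfM mulrAC mulVf ?mul1r// pnatr_eq0.
  rewrite -ge0_integralZl//; last 2 first.
  - by apply: emeasurable_funM; [exact/measurable_EFinP|exact: mI].
  - by move=> v _; apply: mule_ge0; [rewrite lee_fin|exact: I0].
  by apply: eq_integral => v _; rewrite muleCA.
rewrite -integral_nneseries//; last 2 first.
- move=> k; apply: emeasurable_funM; first exact/measurable_EFinP.
  by apply: measurable_funeM; exact: mI.
- move=> k v _; apply: mule_ge0; first by rewrite lee_fin.
  by apply: mule_ge0 => //; exact: I0.
apply: eq_integral => v _.
rewrite nneseriesZl; last by move=> k _; apply: mule_ge0 => //; exact: I0.
rewrite confintE//; last by move=> t; apply: mule_ge0; [exact: cprod0|exact: W0].
exact: (conf_measurableM _ _ mcprod (conf_measurable_consl v mW)).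
Qed.

End ConfigurationIntegral.

(** * Perturbation of the partition function *)

Section PartitionFunction.
Context {R : realType} {d : nat}.
Notation pt := (d.-tuple R).
Notation mu := (@lebd R d).
Notation km k := (tmeas (@lebd R d) k).
Variable phi : pt -> \bar R.
Hypothesis mphi : measurable_fun setT phi.
Hypothesis phi0 : forall x, (0 <= phi x)%E.
Hypothesis phiN : forall x, phi (ptopp x) = phi x.
Implicit Types (a b : pt -> R) (v : pt).

(** The mass [m] is an explicit parameter because it bounds both [Z] ([Zpart_le_exp]) and the effect
    of a perturbation ([insertion_lipschitz]). *)
Definition integrable_activity a (m : R) :=
  [/\ measurable_fun setT a, (forall x, 0 <= a x) &
      (\int[mu]_x (a x)%:E)%E = m%:E].

Lemma integrable_activity_ge0 a m : integrable_activity a m -> 0 <= m.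
Proof.
by case=> _ a0 am; rewrite -lee_fin -am integral_ge0// => x _; rewrite lee_fin.
Qed.

Lemma integrable_activityD a b m n :
  integrable_activity a m -> integrable_activity b n ->
  integrable_activity (fun x => a x + b x) (m + n).
Proof.
move=> [ma a0 am] [mb b0 bn]; split; first exact: measurable_funD.
  by move=> x; rewrite addr_ge0.
under eq_integral do rewrite EFinD.
rewrite ge0_integralD//; [by rewrite am bn| | | |].
- by move=> x _; rewrite lee_fin.
- exact/measurable_EFinP.
- by move=> x _; rewrite lee_fin.
- exact/measurable_EFinP.
Qed.

Lemma ptsubC (x y : pt) : ptsub x y = ptopp (ptsub y x).
Proof. by apply: eq_from_tnth => i; rewrite !tnth_mktuple opprB. Qed.

(** [Hen] sums along the list, so its symmetry rests on the evenness of [phi]. Adjacent swaps are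
    the form of symmetry that [mecke] takes. *)
Lemma Hen_swap (p s : seq pt) x y :
  Hen phi (p ++ x :: y :: s) = Hen phi (p ++ y :: x :: s).
Proof.
elim: p => [|z p IH] /=.
  by rewrite !big_cons (ptsubC x y) phiN -!addeA; congr (_ + _)%E; rewrite addeCA.
rewrite IH; congr (_ + _)%E; apply: perm_big.
by rewrite perm_cat2l (perm_catCA [:: x] [:: y]).
Qed.

Lemma expNH_cons v s :
  expeR (- Hen phi (v :: s)) = (expeR (- Hv phi v s) * expeR (- Hen phi s))%E.
Proof.
by rewrite -expeRD -oppeD// ge0_adde_def ?inE ?Hen_ge0// sume_ge0.
Qed.

(* [Z a * E_a (exp (- H_v))] *)
Definition Zpart_at a v := confint (fun s => expeR (- Hv phi v s) * weight phi a s)%E.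

Lemma measurable_expNHv n :
  measurable_fun setT (fun p : pt * n.-tuple pt => expeR (- Hv phi p.1 p.2)).
Proof.
apply: (measurableT_comp measurable_expeR).
by apply: (measurableT_comp (@oppe_measurable R setT)); exact: measurable_Hv.
Qed.

Lemma conf_measurable_expNHv v : conf_measurable (fun s => expeR (- Hv phi v s)).
Proof.
by move=> n; exact: (measurableT_comp (measurable_expNHv n) (measurable_pair1 v)).
Qed.

Lemma conf_measurable_weight_at a v : measurable_fun setT a ->
  conf_measurable (fun s => expeR (- Hv phi v s) * weight phi a s)%E.
Proof.
move=> ma; apply: conf_measurableM; first exact: conf_measurable_expNHv.
exact: conf_measurable_weight.
Qed.

Lemma weight_at_ge0 a v s : (forall x, 0 <= a x) ->
  (0 <= expeR (- Hv phi v s) * weight phi a s)%E.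
Proof. by move=> a0; rewrite mule_ge0 ?expeR_ge0 ?weight_ge0. Qed.

Lemma measurable_Zpart_at a : measurable_fun setT a -> (forall x, 0 <= a x) ->
  measurable_fun setT (Zpart_at a).
Proof.
move=> ma a0; apply: measurable_confint => [n|v s]; last exact: weight_at_ge0.
apply: emeasurable_funM; first exact: measurable_expNHv.
exact: (measurableT_comp (conf_measurable_weight phi mphi a ma n) measurable_snd).
Qed.

Lemma confint_weight_le a (G : seq pt -> \bar R) : (forall x, 0 <= a x) ->
  (forall s, 0 <= G s <= 1)%E ->
  (0 <= confint (fun s => G s * weight phi a s) <= Zpart phi a)%E.
Proof.
move=> a0 G01; have w0 s : (0 <= weight phi a s)%E by exact: weight_ge0.
have G0 s : (0 <= G s * weight phi a s)%E by rewrite mule_ge0//; case/andP: (G01 s).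
rewrite confint_ge0//=; apply: le_confint => // s.
by rewrite -[leRHS]mul1e lee_wpmul2r//; case/andP: (G01 s).
Qed.

Lemma expNHv_itv v s : (0 <= expeR (- Hv phi v s) <= 1)%E.
Proof. by rewrite expeR_ge0 expeRN_le1// Hv_ge0. Qed.

Lemma confint_pointed_weight a b :
  measurable_fun setT a -> (forall x, 0 <= a x) ->
  measurable_fun setT b -> (forall x, 0 <= b x) ->
  confint (fun s => (pointed_prod b a s)%:E * expeR (- Hen phi s))%E =
  (\int[mu]_v ((b v)%:E * Zpart_at a v))%E.
Proof.
move=> ma a0 mb b0.
rewrite (confint_pointed b a (fun s => expeR (- Hen phi s))%E)//.
- apply: eq_integral => v _; congr (_ * confint _)%E; apply/funext => s.
  by rewrite expNH_cons muleCA.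
- exact: conf_measurable_expNH.
- by move=> s; exact: expeR_ge0.
- by move=> p x y s; rewrite Hen_swap.
Qed.

(** The empty configuration alone contributes 1. *)
Lemma Zpart_ge1 a : measurable_fun setT a -> (forall x, 0 <= a x) ->
  (1 <= Zpart phi a)%E.
Proof.
move=> ma a0.
have mw := conf_measurable_weight phi mphi a ma.
have w0 s : (0 <= weight phi a s)%E by exact: weight_ge0.
rewrite /Zpart confintE// nneseries_recl//; last first.
  by move=> k _; rewrite mule_ge0 ?lee_fin// integral_ge0.
rewrite tmeas0; [|exact: (mw 0%N)|by move=> t].
rewrite /= /weight big_nil /= oppr0 expR0 fact0 invr1 !mul1e leeDl//.
apply: nneseries_ge0 => k _ _; rewrite mule_ge0 ?lee_fin// integral_ge0// => t _.
exact: w0.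
Qed.

(** Since [phi] is nonnegative, dropping the interaction can only increase the sum, and leaves the
    exponential series of the mass. *)
Lemma Zpart_le_exp a m : integrable_activity a m -> (Zpart phi a <= (expR m)%:E)%E.
Proof.
move=> [ma a0 am].
have mw := conf_measurable_weight phi mphi a ma.
have w0 s : (0 <= weight phi a s)%E by exact: weight_ge0.
rewrite /Zpart confintE//.
have -> : (expR m)%:E = (\sum_(0 <= k <oo) (exp_coeff m k)%:E)%E.
  rewrite /expR -EFin_lim; last exact: is_cvg_series_exp_coeff.
  by congr (limn _); apply/funext => n /=; rewrite sumEFin.
apply: lee_nneseries => k _; first by rewrite mule_ge0 ?lee_fin// integral_ge0.
rewrite /exp_coeff/= mulrC EFinM lee_wpmul2l ?lee_fin//.
rewrite -(tmeas_prod _ k a m ma a0 am); apply: ge0_le_integral => //.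
- exact: mw.
- exact: conf_measurable_prod.
- move=> t _; rewrite -[leRHS]mule1 lee_wpmul2l ?lee_fin ?prodr_ge0//.
  by rewrite expeRN_le1// Hen_ge0.
Qed.

Lemma Zpart_fin a m : integrable_activity a m -> Zpart phi a \is a fin_num.
Proof.
move=> am; have [ma a0 _] := am.
rewrite ge0_fin_numE; last by rewrite (le_trans _ (Zpart_ge1 a ma a0)).
by rewrite (le_lt_trans (Zpart_le_exp a m am))// ltry.
Qed.

Lemma le_Zpart_atD a b v : (forall x, 0 <= a x) -> (forall x, 0 <= b x) ->
  (Zpart_at a v <= Zpart_at (fun x => (a x + b x)%R) v)%E.
Proof.
move=> a0 b0; apply: le_confint.
- by move=> s; exact: weight_at_ge0.
- move=> s; rewrite lee_wpmul2l ?expeR_ge0// lee_wpmul2r ?expeR_ge0// lee_fin.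
  by apply: ler_prod => y _; rewrite a0 lerDl b0.
Qed.

Lemma ZpartD_lower a b :
  measurable_fun setT a -> (forall x, 0 <= a x) ->
  measurable_fun setT b -> (forall x, 0 <= b x) ->
  (Zpart phi a + \int[mu]_v ((b v)%:E * Zpart_at a v) <=
   Zpart phi (fun x => (a x + b x)%R))%E.
Proof.
move=> ma a0 mb b0; rewrite -confint_pointed_weight// /Zpart.
have mD : conf_measurable (fun s => (pointed_prod b a s)%:E * expeR (- Hen phi s))%E.
  apply: conf_measurableM; first exact: conf_measurable_pointed.
  exact: conf_measurable_expNH.
have D0 s : (0 <= (pointed_prod b a s)%:E * expeR (- Hen phi s))%E.
  by rewrite mule_ge0 ?expeR_ge0// lee_fin pointed_prod_ge0.
rewrite -confintD//.
- apply: le_confint.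
  + by move=> s; rewrite adde_ge0// weight_ge0.
  + move=> s; rewrite /weight -ge0_muleDl ?lee_fin ?prodr_ge0 ?pointed_prod_ge0//.
    by rewrite lee_wpmul2r ?expeR_ge0// -EFinD lee_fin prod_add_lower.
- exact: conf_measurable_weight.
- by move=> s; rewrite weight_ge0.
Qed.

(** The factor [E] serves two purposes: [E = 1] bounds the growth of [Z], and [E = exp (- H_v)]
    bounds the growth of the numerator of the insertion probability. On the pointed term it is
    estimated by 1. *)
Lemma confintD_upper a b (E : seq pt -> \bar R) :
  measurable_fun setT a -> (forall x, 0 <= a x) ->
  measurable_fun setT b -> (forall x, 0 <= b x) ->
  conf_measurable E -> (forall s, 0 <= E s <= 1)%E ->
  (confint (fun s => E s * weight phi (fun x => (a x + b x)%R) s) <=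
   confint (fun s => E s * weight phi a s) +
   \int[mu]_v ((b v)%:E * Zpart_at (fun x => (a x + b x)%R) v))%E.
Proof.
move=> ma a0 mb b0 mE E01.
have E0 s : (0 <= E s)%E by have /andP[] := E01 s.
pose ab x := a x + b x.
have mab : measurable_fun setT ab by exact: measurable_funD.
have ab0 x : 0 <= ab x by rewrite addr_ge0.
rewrite -(confint_pointed_weight ab)//.
have mD : conf_measurable (fun s => (pointed_prod b ab s)%:E * expeR (- Hen phi s))%E.
  apply: conf_measurableM; first exact: conf_measurable_pointed.
  exact: conf_measurable_expNH.
have D0 s : (0 <= (pointed_prod b ab s)%:E * expeR (- Hen phi s))%E.
  by rewrite mule_ge0 ?expeR_ge0// lee_fin pointed_prod_ge0.
have mEw c : measurable_fun setT c -> conf_measurable (fun s => E s * weight phi c s)%E.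
  by move=> mc; apply: conf_measurableM => //; exact: conf_measurable_weight.
rewrite -confintD//.
- apply: le_confint.
  + by move=> s; rewrite mule_ge0// weight_ge0.
  + move=> s; apply: (@le_trans _ _ (E s * (weight phi a s +
       (pointed_prod b ab s)%:E * expeR (- Hen phi s))))%E.
      rewrite lee_wpmul2l// /weight -ge0_muleDl ?lee_fin ?prodr_ge0 ?pointed_prod_ge0//.
      by rewrite lee_wpmul2r ?expeR_ge0// -EFinD lee_fin prod_add_upper.
    rewrite ge0_muleDr ?weight_ge0// leeD2l// -[leRHS]mul1e lee_wpmul2r//.
    by have /andP[] := E01 s.
- exact: mEw.
- by move=> s; rewrite mule_ge0// weight_ge0.
Qed.

Definition Zr a : R := fine (Zpart phi a).

(* the paper's [E_a (exp (- H_v))] *)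
Definition insertion a v : R := gibbsE phi a (fun s => expeR (- Hv phi v s)).

Section Integrable.
Variables (a : pt -> R) (A : R).
Hypothesis aA : integrable_activity a A.

Lemma Zr_ge1 : 1 <= Zr a.
Proof.
have [ma a0 _] := aA; rewrite -lee_fin fineK; last exact: Zpart_fin aA.
exact: Zpart_ge1.
Qed.

Lemma ZrE : Zpart phi a = (Zr a)%:E.
Proof. by rewrite fineK//; exact: Zpart_fin aA. Qed.

Lemma Zr_gt0 : 0 < Zr a.
Proof. exact: lt_le_trans Zr_ge1. Qed.

Lemma confint_gibbsE (G : seq pt -> \bar R) : (forall s, 0 <= G s <= 1)%E ->
  confint (fun s => G s * weight phi a s)%E = (gibbsE phi a G * Zr a)%:E.
Proof.
have [_ a0 _] := aA => G01; have /andP[ge0 le] := confint_weight_le a G a0 G01.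
rewrite /gibbsE -/(Zr a) divfK ?gt_eqF ?Zr_gt0//.
by rewrite fineK// ge0_fin_numE// (le_lt_trans le)// ZrE ltry.
Qed.

Lemma gibbsE_itv (G : seq pt -> \bar R) : (forall s, 0 <= G s <= 1)%E ->
  0 <= gibbsE phi a G <= 1.
Proof.
have [_ a0 _] := aA => G01; have := confint_weight_le a G a0 G01.
rewrite confint_gibbsE// ZrE !lee_fin pmulr_lge0 ?Zr_gt0//.
by rewrite -{2}[Zr a]mul1r ler_pM2r// Zr_gt0.
Qed.

Lemma Zpart_atE v : Zpart_at a v = (insertion a v * Zr a)%:E.
Proof. by rewrite /Zpart_at confint_gibbsE// => s; exact: expNHv_itv. Qed.

Lemma insertion_ge0 v : 0 <= insertion a v.
Proof. by have /andP[] := gibbsE_itv _ (expNHv_itv v). Qed.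

Lemma insertion_le1 v : insertion a v <= 1.
Proof. by have /andP[] := gibbsE_itv _ (expNHv_itv v). Qed.

Lemma measurable_insertion : measurable_fun setT (insertion a).
Proof.
have [ma a0 _] := aA.
rewrite (_ : insertion a = fun v => fine (Zpart_at a v) / Zr a); last first.
  by apply/funext => v; rewrite Zpart_atE/= mulfK// gt_eqF// Zr_gt0.
apply: measurable_funM => //; apply: (measurableT_comp (@fine_measurable R setT measurableT)).
exact: measurable_Zpart_at.
Qed.

End Integrable.

Lemma integral_Zpart_at a b A B : integrable_activity a A -> integrable_activity b B ->
  (\int[mu]_v ((b v)%:E * Zpart_at a v))%E =
  ((Zr a)%:E * \int[mu]_v (b v * insertion a v)%:E)%E.
Proof.
move=> aA bB; have [mb b0 _] := bB.
rewrite -ge0_integralZl//.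
- apply: eq_integral => v _; rewrite (Zpart_atE _ _ aA) -!EFinM.
  by rewrite mulrA mulrC.
- by apply/measurable_EFinP; apply: measurable_funM => //; exact: (measurable_insertion _ _ aA).
- by move=> v _; rewrite lee_fin mulr_ge0// (insertion_ge0 _ _ aA).
- by rewrite lee_fin ltW// (Zr_gt0 _ _ aA).
Qed.

Section Increment.
Variables (a b : pt -> R) (A m : R).
Hypotheses (aA : integrable_activity a A) (bm : integrable_activity b m).
Let ab x := a x + b x.
Let abAm : integrable_activity ab (A + m) := integrable_activityD _ _ _ _ aA bm.

Lemma Zr_incr_lower (K : R) :
  (K%:E <= \int[mu]_v (b v * insertion a v)%:E)%E ->
  Zr a * (1 + K) <= Zr ab.
Proof.
move=> hK; have [ma a0 _] := aA; have [mb b0 _] := bm.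
rewrite -lee_fin -(ZrE _ _ abAm); apply: le_trans (ZpartD_lower _ _ ma a0 mb b0).
rewrite (integral_Zpart_at _ _ _ _ aA bm) (ZrE _ _ aA) mulrDr mulr1 EFinD leeD2l//.
by rewrite EFinM lee_wpmul2l// lee_fin ltW// (Zr_gt0 _ _ aA).
Qed.

Lemma insertion_mass : (\int[mu]_v (b v * insertion ab v)%:E <= m%:E)%E.
Proof.
have [mb b0 bE] := bm; rewrite -bE; apply: ge0_le_integral => //.
- by move=> v _; rewrite lee_fin mulr_ge0// (insertion_ge0 _ _ abAm).
- by apply/measurable_EFinP; apply: measurable_funM => //; exact: (measurable_insertion _ _ abAm).
- exact/measurable_EFinP.
- by move=> v _; rewrite lee_fin ler_piMr// (insertion_le1 _ _ abAm).
Qed.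

Lemma Zr_incr_upper (K : R) :
  (\int[mu]_v (b v * insertion ab v)%:E <= K%:E)%E ->
  Zr ab * (1 - K) <= Zr a.
Proof.
move=> hK; have [ma a0 _] := aA; have [mb b0 _] := bm.
have := @confintD_upper a b (fun=> 1%E) ma a0 mb b0.
have E1 c : confint (fun s => 1 * weight phi c s)%E = Zpart phi c.
  by congr confint; apply/funext => s; rewrite mul1e.
rewrite !E1 (integral_Zpart_at _ _ _ _ abAm bm) (ZrE _ _ abAm) (ZrE _ _ aA).
move=> /(_ _ _)/le_trans h.
rewrite mulrBr mulr1 lerBlDr -lee_fin EFinD; apply: h.
- by move=> n; exact: measurable_cst.
- by move=> s; rewrite lexx lee_fin ler01.
- by rewrite leeD2l// EFinM lee_wpmul2l// lee_fin ltW// (Zr_gt0 _ _ abAm).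
Qed.

(** Numerator and denominator of the insertion probability both grow when [b] is added, each by at
    most [m * Zr ab]. Their growths push the ratio in opposite directions, so the constant is [m]
    and not [2 * m]. *)
Lemma insertion_lipschitz v : `|insertion ab v - insertion a v| <= m.
Proof.
have [ma a0 _] := aA; have [mb b0 _] := bm.
have m0 := integrable_activity_ge0 _ _ bm.
have Za := Zr_gt0 _ _ aA; have Zab := Zr_gt0 _ _ abAm.
have le1 : Zr a <= Zr ab.
  have := @Zr_incr_lower 0; rewrite addr0 mulr1; apply.
  by apply: integral_ge0 => x _; rewrite lee_fin mulr_ge0// (insertion_ge0 _ _ aA).
have le2 : Zr ab * (1 - m) <= Zr a by apply: Zr_incr_upper; exact: insertion_mass.
have le3 : insertion a v * Zr a <= insertion ab v * Zr ab.
  rewrite -lee_fin -(Zpart_atE _ _ aA) -(Zpart_atE _ _ abAm).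
  exact: le_Zpart_atD.
have le4 : insertion ab v * Zr ab <= insertion a v * Zr a + Zr ab * m.
  have h : (Zpart_at ab v <= Zpart_at a v + (Zr ab * m)%:E)%E.
    apply: le_trans (confintD_upper a b _ ma a0 mb b0 _ _) _.
    - exact: conf_measurable_expNHv.
    - by move=> s; exact: expNHv_itv.
    - rewrite (integral_Zpart_at _ _ _ _ abAm bm); apply: leeD2l.
      by rewrite EFinM; apply: lee_wpmul2l; rewrite ?insertion_mass// lee_fin ltW.
  by move: h; rewrite (Zpart_atE _ _ aA) (Zpart_atE _ _ abAm) -EFinD lee_fin.
have q0 := insertion_ge0 _ _ aA v; have q1 := insertion_le1 _ _ aA v.
have p0 := insertion_ge0 _ _ abAm v; have p1 := insertion_le1 _ _ abAm v.
rewrite ler_norml; apply/andP; split.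
- rewrite lerNl opprB lerBlDr -(ler_pM2r Zab).
  have h : insertion a v * (Zr ab * (1 - m)) <= insertion a v * Zr a by rewrite ler_wpM2l.
  have h2 : insertion a v * (Zr ab * m) <= Zr ab * m.
    by rewrite ler_piMl// mulr_ge0// ltW.
  by rewrite mulrDl (mulrC m); nra.
- rewrite lerBlDr -(ler_pM2r Zab) mulrDl (mulrC m).
  have h : insertion a v * Zr a <= insertion a v * Zr ab by rewrite ler_wpM2l.
  lra.
Qed.

End Increment.

End PartitionFunction.

(** * Cubes, half-spaces and slabs *)

Section Geometry.
Context {R : realType} {d : nat}.
Notation pt := (d.-tuple R).
Notation mu := (@lebd R d).
Implicit Types (x u v : pt).

Definition cube v (r : R) : set pt :=
  [set x | forall i, `|tnth x i - tnth v i| <= r].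

Definition ptscale (c : R) x : pt := [tuple c * tnth x i | i < d].

Lemma tnth_pt0 i : tnth (pt0 R d) i = 0.
Proof. by rewrite tnth_mktuple. Qed.

Lemma boxLE n : @boxL R d n = cube (pt0 R d) n%:R.
Proof.
by apply/seteqP; split => x h i; have := h i; rewrite tnth_pt0 subr0.
Qed.

Lemma measurable_tnthR i : measurable_fun setT (fun x => tnth x i : R).
Proof. exact: measurable_tnth. Qed.

Lemma measurable_ptadd v : measurable_fun setT (fun x => ptadd d x v).
Proof.
apply/measurable_fun_tnthP => i.
rewrite (_ : _ \o _ = fun x => tnth x i + tnth v i); last first.
  by apply/funext => x /=; rewrite tnth_mktuple.
by apply: measurable_funD => //; exact: measurable_tnthR.
Qed.

Lemma measurable_inner u : measurable_fun setT (inner u).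
Proof.
rewrite (_ : inner u = fun x => \sum_(i < d) tnth u i * tnth x i)//.
by apply: measurable_sum => i; apply: measurable_funM => //; exact: measurable_tnthR.
Qed.

Lemma measurable_halfspace u (t : R) : measurable [set x | t <= inner u x].
Proof.
rewrite -[X in measurable X]setTI.
by apply: measurable_fun_le => //; exact: measurable_inner.
Qed.

Lemma measurable_cube v r : measurable (cube v r).
Proof.
rewrite (_ : cube v r = \bigcap_(i in [set: 'I_d])
    [set x | `|tnth x i - tnth v i| <= r]); last first.
  by apply/seteqP; split => x h i; [move=> _; exact: h|exact: (h i)].
apply: fin_bigcap_measurable => // i _; rewrite -[X in measurable X]setTI.
apply: measurable_fun_le => //; apply: measurableT_comp => //.
by apply: measurable_funB => //; exact: measurable_tnthR.
Qed.

Lemma lebd_indic (A : set pt) : measurable A ->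
  mu A = (\int[mu]_x (\1_A x)%:E)%E.
Proof. by move=> mA; rewrite integral_indic// setIT. Qed.

Lemma lebd_preimage_shift v (A : set pt) : measurable A ->
  mu [set x | A (ptadd d x v)] = mu A.
Proof.
move=> mA.
have mA' : measurable [set x | A (ptadd d x v)].
  by rewrite -[X in measurable X]setTI; exact: measurable_ptadd.
rewrite !lebd_indic// -[RHS](lebd_shift d v).
- by apply: eq_integral => x _; rewrite !indicE.
- by apply/measurable_EFinP.
- by move=> x; rewrite lee_fin.
Qed.

Lemma cube_shift v r : cube v r = [set x | cube (pt0 R d) r (ptadd d x (ptopp v))].
Proof.
by apply/seteqP; split => x h i; have := h i;
  rewrite tnth_pt0 subr0 !tnth_mktuple.
Qed.

(** The indicator of a cube is a product of indicators in the single coordinates, so [tmeas_prod]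
    applies. *)
Lemma lebd_cube v (r : R) : 0 <= r -> mu (cube v r) = ((2 * r) ^+ d)%:E.
Proof.
move=> r0; rewrite cube_shift lebd_preimage_shift; last exact: measurable_cube.
pose f : R -> R := \1_(`[- r, r]%classic : set R).
have mI : measurable (`[- r, r]%classic : set R) by exact: measurable_itv.
have <- := @tmeas_prod _ _ _ (@leb R) d f (2 * r).
- rewrite lebd_indic; last exact: measurable_cube.
  apply: eq_integral => x _; congr EFin; rewrite indicE big_tuple.
  have [xc|xc] := boolP (x \in _).
    rewrite big1// => i _; rewrite /f indicE mem_set//=.
    by have := set_mem xc; move=> /(_ i); rewrite tnth_pt0 subr0 in_itv/= ler_norml.
  apply/esym/eqP; rewrite prodf_seq_eq0; apply/hasP.
  have [i hi] : exists i, ~~ (`|tnth x i| <= r).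
    apply/existsP; rewrite -negb_forall; apply: contra xc => /forallP xc.
    by apply/mem_set => i; rewrite tnth_pt0 subr0.
  exists i; first by rewrite mem_index_enum.
  rewrite /= /f indicE memNset//= in_itv/= -ler_norml.
  exact/negP.
- exact: measurable_indic.
- by [].
- rewrite integral_indic// setIT [LHS]lebE// lebesgue_measure_itv/= lte_fin.
  case: ltP => [_|h]; first by rewrite -EFinB; congr EFin; rewrite opprK mulr_natl mulr2n.
  have -> : r = 0 by apply/eqP; rewrite eq_le r0 andbT; lra.
  by rewrite mulr0.
Qed.

Lemma volE (A : set pt) : measurable A -> vol A = fine (mu A).
Proof.
by move=> mA; rewrite /vol iintE ?lebd_indic//; exact/measurable_EFinP.
Qed.

Lemma vol_cube v (r : R) : 0 <= r -> vol (cube v r) = (2 * r) ^+ d.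
Proof. by move=> r0; rewrite volE ?lebd_cube//; exact: measurable_cube. Qed.

Lemma tnth_le_enorm x i : `|tnth x i| <= enorm x.
Proof.
rewrite /enorm -sqrtr_sqr ler_wsqrtr// (bigD1 i)//= lerDl.
by apply: sumr_ge0 => j _; rewrite sqr_ge0.
Qed.

Lemma enorm_le x (r : R) : 0 <= r -> (forall i, `|tnth x i| <= r) ->
  enorm x <= d%:R * r.
Proof.
move=> r0 h; rewrite -[leRHS]ger0_norm ?mulr_ge0// -sqrtr_sqr /enorm ler_wsqrtr//.
apply: (@le_trans _ _ (\sum_(i < d) r ^+ 2)).
  apply: ler_sum => i _; rewrite -[tnth x i ^+ 2]real_normK ?num_real//.
  by rewrite lerXn2r// nnegrE.
rewrite sumr_const card_ord -[leLHS]mulr_natl exprMn ler_wpM2r ?sqr_ge0//.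
by rewrite -natrX ler_nat -mulnn; case: (d) => // n; rewrite leq_pmulr.
Qed.

Lemma inner_ptadd u x v : inner u (ptadd d x v) = inner u x + inner u v.
Proof.
by rewrite /inner -big_split; apply: eq_bigr => i _; rewrite tnth_mktuple mulrDr.
Qed.

Lemma inner_ptscale u c x : inner u (ptscale c x) = c * inner u x.
Proof.
by rewrite /inner mulr_sumr; apply: eq_bigr => i _; rewrite tnth_mktuple mulrCA.
Qed.

Lemma innerxx u : inner u u = \sum_(i < d) tnth u i ^+ 2.
Proof. by apply: eq_bigr => i _; rewrite expr2. Qed.

(** Half-open, so that consecutive slabs tile a half-space without overlap. *)
Definition slab u (t w : R) : set pt := [set x | t <= inner u x < t + w].

Lemma measurable_slab u t w : measurable (slab u t w).
Proof.
rewrite (_ : slab u t w = [set x | t <= inner u x] `\` [set x | t + w <= inner u x]).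
  by apply: measurableD; exact: measurable_halfspace.
apply/seteqP; split => x /=; first by move=> /andP[-> ]; rewrite ltNge => /negP.
by move=> [tx /negP]; rewrite -ltNge => xw; apply/andP.
Qed.

Lemma slab_mass u t (M : nat) (r : R) : \sum_(i < d) tnth u i ^+ 2 = 1 ->
  (0 < M)%N -> 0 <= r ->
  (mu (slab u t M%:R^-1 `&` cube (pt0 R d) r) <=
   ((2 * (r + 1)) ^+ d / M%:R)%:E)%E.
Proof.
move=> u1 M0 r0; set S := slab _ _ _ `&` _.
have MR0 : 0 < M%:R :> R by rewrite ltr0n.
have mS : measurable S by apply: measurableI; [exact: measurable_slab|exact: measurable_cube].
(* The [M] translates of the slab piece by [(i / M) *: u] are disjoint. *)
pose sh (i : 'I_M) := ptscale (- (i%:R / M%:R)) u.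
pose T i : set pt := [set x | S (ptadd d x (sh i))].
have mT i : measurable (T i).
  by rewrite -[X in measurable X]setTI; exact: measurable_ptadd.
have Tin i x : T i x -> t + i%:R / M%:R <= inner u x < t + i%:R / M%:R + M%:R^-1.
  move=> [/andP[]]; rewrite /= inner_ptadd inner_ptscale innerxx u1 mulr1.
  by move=> h1 h2 _; apply/andP; split; lra.
have tT : trivIset [set: 'I_M] T.
  apply/trivIsetP => i j _ _; rewrite neq_lt.
  wlog ij : i j / (i < j)%O => [wl|_].
    case/orP => h; first by apply: wl => //; rewrite h.
    by rewrite setIC; apply: wl => //; rewrite h.
  apply/seteqP; split => // x [/Tin/andP[_ h1] /Tin/andP[h2 _]].
  have : i%:R / M%:R + M%:R^-1 <= j%:R / M%:R :> R.
    have : i.+1%:R / M%:R <= j%:R / M%:R :> R.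
      by rewrite ler_pM2r ?invr_gt0// ler_nat.
    by rewrite -natr1 mulrDl mul1r.
  lra.
(* The shifts are [i / M < 1] times a unit vector, so all translates stay in the cube enlarged by
   1. *)
have Tsub : \big[setU/set0]_(i < M) T i `<=` cube (pt0 R d) (r + 1).
  rewrite -bigcup_seq => x [i _ [_ h]] k; have := h k.
  rewrite tnth_pt0 !subr0 !tnth_mktuple => hk.
  have uk : `|tnth u k| <= 1.
    by rewrite (le_trans (tnth_le_enorm u k))// /enorm u1 sqrtr1.
  have iM : `|- (i%:R / M%:R) * tnth u k| <= 1 :> R.
    rewrite normrM normrN mulr_ile1// ger0_norm ?divr_ge0//.
    by rewrite ler_pdivrMr// mul1r ler_nat ltnW.
  have := ler_normD (tnth x k + - (i%:R / M%:R) * tnth u k) (- (- (i%:R / M%:R) * tnth u k)).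
  rewrite addrK normrN => h3; apply: (le_trans h3); exact: lerD.
have muT i : mu (T i) = mu S by exact: lebd_preimage_shift.
have : (mu (\big[setU/set0]_(i < M) T i) <= ((2 * (r + 1)) ^+ d)%:E)%E.
  rewrite -(lebd_cube (pt0 R d)) ?addr_ge0//; apply: le_measure => //; rewrite inE.
    by apply: bigsetU_measurable.
  exact: measurable_cube.
have Sfin : mu S \is a fin_num.
  rewrite ge0_fin_numE ?measure_ge0//.
  apply: (@le_lt_trans _ _ (mu (cube (pt0 R d) r))); last by rewrite lebd_cube// ltry.
  apply: le_measure; [by rewrite inE|rewrite inE; exact: measurable_cube|exact: subIsetr].
rewrite measure_bigsetU_ord//.
rewrite (eq_bigr (fun=> (fine (mu S))%:E)); last first.
  by move=> i _; rewrite (fineK Sfin); exact: muT.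
rewrite sumEFin sumr_const card_ord lee_fin -[leLHS]mulr_natr => h.
by rewrite -(fineK Sfin) lee_fin ler_pdivlMr.
Qed.

End Geometry.

(** * Strong spatial mixing for insertion probabilities *)

Section Translation.
Context {R : realType} {d : nat}.
Notation pt := (d.-tuple R).
Variable phi : pt -> \bar R.
Hypothesis mphi : measurable_fun setT phi.

Let tr (v x : pt) : pt := ptadd d x v.

Lemma confint_map_shift v (F : seq pt -> \bar R) :
  conf_measurable F -> (forall s, 0 <= F s)%E ->
  confint (fun s => F (map (tr v) s)) = confint F.
Proof.
move=> mF F0.
have mm n : measurable_fun setT (fun t : n.-tuple pt => map_tuple (tr v) t).
  apply/measurable_fun_tnthP => i.
  rewrite (_ : _ \o _ = (tr v) \o (@tnth _ _ ^~ i)).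
    by apply: measurableT_comp (measurable_ptadd v) (measurable_tnth i).
  by apply/funext => t /=; rewrite tnth_map.
rewrite !confintE//; last by move=> n; exact: (measurableT_comp (mF n) (mm n)).
congr (limn _); apply/funext => n; apply: eq_bigr => k _; congr (_ * _)%E.
rewrite -(tmeas_map _ k (fun=> tr v) (fun t => F t))//.
- apply: eq_integral => t _; congr F.
  rewrite -[LHS]/(val (map_tuple (tr v) t)); congr val.
  by apply: eq_from_tnth => i; rewrite tnth_map tnth_mktuple.
- by move=> _; exact: measurable_ptadd.
- by move=> _ f mf f0; exact: lebd_shift.
Qed.

Lemma Hen_map_shift v s : Hen phi (map (tr v) s) = Hen phi s.
Proof.
elim: s => [//|x s IH] /=; rewrite IH big_map; congr (_ + _)%E.
apply: eq_bigr => y _; congr phi; apply: eq_from_tnth => i.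
by rewrite !tnth_mktuple opprD addrACA subrr addr0.
Qed.

Lemma Hv_map_shift v s : Hv phi v (map (tr v) s) = Hv phi (pt0 R d) s.
Proof.
rewrite /Hv big_map; apply: eq_bigr => y _; congr phi; apply: eq_from_tnth => i.
by rewrite !tnth_mktuple opprD addrCA subrr addr0 sub0r.
Qed.

Lemma weight_map_shift (a : pt -> R) v s :
  weight phi a (map (tr v) s) = weight phi (fun x => a (ptadd d x v)) s.
Proof. by rewrite /weight Hen_map_shift big_map. Qed.

Lemma insertion_shift (a : pt -> R) v : measurable_fun setT a -> (forall x, 0 <= a x) ->
  insertion phi a v = insertion phi (fun x => a (ptadd d x v)) (pt0 R d).
Proof.
move=> ma a0; rewrite /insertion /gibbsE; congr (fine _ / fine _).
- rewrite -(confint_map_shift v).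
  + by congr confint; apply/funext => s; rewrite weight_map_shift Hv_map_shift.
  + exact: conf_measurable_weight_at.
  + by move=> s; exact: weight_at_ge0.
- rewrite /Zpart -(confint_map_shift v).
  + by congr confint; apply/funext => s; rewrite weight_map_shift.
  + exact: conf_measurable_weight.
  + by move=> s; exact: weight_ge0.
Qed.

End Translation.

Section LayerCake.
Context {R : realType}.

(** The sum counts the integers from 1 to [n] that do not exceed [z], that is [min n (floor z)].
    With [sum_levels_ge] it approximates [z] to within 1, a discrete layer-cake formula. *)
Lemma sum_levels_le (z : R) n : 0 <= z ->
  \sum_(j < n) (j.+1%:R <= z)%R%:R <= z :> R.
Proof.
move=> z0; elim: n => [|n IH]; first by rewrite big_ord0.
rewrite big_ord_recr /=; have [h|_] := leP n.+1%:R z; last by rewrite addr0.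
apply: le_trans h; rewrite -natr1 lerD2r.
apply: (@le_trans _ _ (\sum_(j < n) 1)); last by rewrite sumr_const card_ord.
by apply: ler_sum => j _; rewrite lern1 leq_b1.
Qed.

Lemma sum_levels_ge (z : R) n : z <= n%:R ->
  z <= \sum_(j < n) (j.+1%:R <= z)%R%:R + 1 :> R.
Proof.
elim: n => [|n IH]; first by rewrite big_ord0 add0r => /le_trans; apply.
move=> zn; have [zn'|zn'] := leP z n%:R.
  by apply: (le_trans (IH zn')); rewrite lerD2r big_ord_recr/= lerDl.
apply: (le_trans zn); rewrite -natr1 lerD2r.
apply: (@le_trans _ _ (\sum_(j < n) 1)); first by rewrite sumr_const card_ord.
rewrite big_ord_recr/= -[leLHS]addr0 lerD//.
apply: ler_sum => j _; rewrite (_ : (_ <= z)%R = true)//.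
by rewrite (le_trans _ (ltW zn'))// ler_nat.
Qed.

End LayerCake.

Section TotalVariation.
Context {R : realType} {d : nat}.
Notation pt := (d.-tuple R).
Variable phi : pt -> \bar R.
Hypothesis mphi : measurable_fun setT phi.
Hypothesis phi0 : forall x, (0 <= phi x)%E.
Implicit Types (a b : pt -> R) (G : seq pt -> \bar R).

Lemma tv_restr_ub a b A B L (E : set (seq pt)) :
  integrable_activity a A -> integrable_activity b B -> config_event E ->
  `|gibbsE phi a (fun s => (\1_E (restr L s))%:E) -
    gibbsE phi b (fun s => (\1_E (restr L s))%:E)| <= tv_restr phi a b L.
Proof.
move=> aA bB evE; apply: ub_le_sup; last by exists E.
(* A real [sup] bounds its set only when the set is bounded above; differences of probabilities are
   at most 1. *)
exists 1 => _ [E' _ <-].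
have i01 s : (0 <= (\1_E' (restr L s) : R)%:E <= 1)%E.
  by rewrite indicE !lee_fin; case: (_ \in _); rewrite ?ler01 ?lexx.
have /andP[a0 a1] := gibbsE_itv phi mphi phi0 a A aA _ i01.
have /andP[b0 b1] := gibbsE_itv phi mphi phi0 b B bB _ i01.
by rewrite ler_norml; apply/andP; split; lra.
Qed.

Lemma insertion_tv a b A B v (L : set pt) :
  integrable_activity a A -> integrable_activity b B ->
  (forall x, ~ L x -> phi (ptsub v x) = 0%E) ->
  `|insertion phi a v - insertion phi b v| <= tv_restr phi a b L.
Proof.
move=> aA bB phiL; pose E s := expeR (- Hv phi v s).
have mE : conf_measurable E by exact: conf_measurable_expNHv.
have E01 s : (0 <= E s <= 1)%E by exact: expNHv_itv.
have Efin s : E s \is a fin_num.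
  have /andP[h0 h1] := E01 s; rewrite ge0_fin_numE//.
  by rewrite (le_lt_trans h1)// ltry.
(* Points outside [L] do not interact with [v], so [E] and its level sets see only the restriction
   to [L]. *)
have Erestr s : E (restr L s) = E s.
  rewrite /E; congr (expeR (- _)); rewrite /Hv /restr big_filter big_mkcond.
  apply: eq_bigr => x _; case: asboolP => // /phiL; by [].
(* Approximate [E] by a combination of indicators of its level sets, to which
   the total variation distance applies. *)
pose lev c : set (seq pt) := [set s | (c%:E <= E s)%E].
have mlev c n : measurable [set t : n.-tuple pt | lev c (tval t)].
  rewrite -[X in measurable X]setTI.
  by apply: emeasurable_fun_c_infty => //; exact: mE.
have evlev c : config_event (lev c).
  split; last exact: mlev.
  by move=> s s' ss'; rewrite /lev/= /E /Hv (perm_big _ ss').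
pose p f c := gibbsE phi f (fun s => (\1_(lev c) s)%:E).
have ptv c : `|p a c - p b c| <= tv_restr phi a b L.
  have := tv_restr_ub a b A B L (lev c) aA bB (evlev c).
  rewrite (_ : (fun s => (\1_(lev c) (restr L s))%:E) = (fun s => (\1_(lev c) s)%:E))//.
  apply/funext => s; rewrite !indicE; congr (_%:R%:E); congr nat_of_bool.
  by apply/idP/idP => /set_mem h; apply/mem_set; move: h; rewrite /lev/= Erestr.
have i01 c s : (0 <= (\1_(lev c) s : R)%:E <= 1)%E.
  by rewrite indicE !lee_fin; case: (_ \in _); rewrite ?ler01 ?lexx.
have mi c : conf_measurable (fun s => (\1_(lev c) s)%:E).
  move=> n; apply/measurable_EFinP.
  exact: (@measurable_indic _ _ _ setT _ (mlev c n)).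
(* A lower sum for the layer-cake integral of the mean of [E], with error at most [1/(N+1)]. Each
   level moves by at most the total variation distance and the weights add up to 1, so [S] moves by
   no more than that distance. *)
pose S f N := \sum_(j < N.+1) N.+1%:R^-1 * p f (j.+1%:R / N.+1%:R).
have layer f F N : integrable_activity f F ->
    S f N <= insertion phi f v <= S f N + N.+1%:R^-1.
  move=> fF; have [mf f0 _] := fF.
  have w0 s : (0 <= weight phi f s)%E by exact: weight_ge0.
  have mw : conf_measurable (weight phi f) by exact: conf_measurable_weight.
  have Z0 := Zr_gt0 phi mphi phi0 f F fF.
  pose t j := j.+1%:R / N.+1%:R : R.
  pose W s := (\sum_(j < N.+1) (N.+1%:R^-1)%:E * ((\1_(lev (t j)) s)%:E * weight phi f s))%E.
  have t0 j s : (0 <= (\1_(lev (t j)) s)%:E * weight phi f s)%E.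
    by rewrite mule_ge0// lee_fin.
  have mt j : conf_measurable (fun s => (\1_(lev (t j)) s)%:E * weight phi f s)%E.
    exact: conf_measurableM.
  have N0 : 0 <= (N.+1%:R^-1 : R) by rewrite invr_ge0.
  have mW : conf_measurable W.
    move=> n; apply: emeasurable_sum => j; apply: measurable_funeM; exact: mt.
  have W0 s : (0 <= W s)%E by apply: sume_ge0 => j _; rewrite mule_ge0// lee_fin.
  have WE : confint W = (S f N * Zr phi f)%:E.
    rewrite /W confint_sum.
    - rewrite mulr_suml -sumEFin; apply: eq_bigr => j _.
      by rewrite confintZl// (confint_gibbsE phi mphi phi0 f F fF)// -EFinM mulrA.
    - by move=> j n; apply: measurable_funeM; exact: mt.
    - by move=> j s; rewrite mule_ge0// lee_fin.
  have WS s : W s = ((\sum_(j < N.+1) (j.+1%:R <= fine (E s) * N.+1%:R)%R%:R / N.+1%:R)%:E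
      * weight phi f s)%E.
    rewrite -sumEFin ge0_sume_distrl; last by move=> j _; rewrite lee_fin mulr_ge0.
    apply: eq_bigr => j _; rewrite muleA -EFinM; congr (_%:E * _)%E.
    rewrite mulrC indicE; congr (_%:R / _); congr nat_of_bool.
    rewrite -ler_pdivrMr//; apply/idP/idP => [/set_mem|h].
      by rewrite /lev/= -{1}(fineK (Efin s)) lee_fin.
    by apply/mem_set; rewrite /lev/= -(fineK (Efin s)) lee_fin.
  have y01 s : 0 <= fine (E s) <= 1.
    have /andP[h0 h1] := E01 s.
    by rewrite fine_ge0//= -lee_fin fineK.
  apply/andP; split.
  - rewrite -(ler_pM2r Z0) -lee_fin -WE -(confint_gibbsE phi mphi phi0 f F fF E)//.
    apply: le_confint => // s; rewrite WS lee_wpmul2r// -(fineK (Efin s)) lee_fin -mulr_suml.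
    rewrite ler_pdivrMr// sum_levels_le// mulr_ge0//.
    by have /andP[] := y01 s.
  - rewrite -(ler_pM2r Z0) mulrDl -lee_fin EFinD -WE -(confint_gibbsE phi mphi phi0 f F fF E)//.
    rewrite EFinM -(ZrE phi mphi phi0 f F fF) /Zpart -confintZl// -confintD//; last 2 first.
    - by move=> n; apply: measurable_funeM; exact: mw.
    - by move=> s; rewrite mule_ge0// lee_fin.
    apply: le_confint.
      by move=> s; rewrite mule_ge0//; case/andP: (E01 s).
    move=> s; rewrite WS -ge0_muleDl ?lee_fin//; last first.
      by apply: sumr_ge0 => j _; rewrite mulr_ge0.
    rewrite lee_wpmul2r// -(fineK (Efin s)) -EFinD lee_fin -mulr_suml.
    rewrite -[X in _ + X]mul1r -mulrDl ler_pdivlMr// sum_levels_ge//.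
    by rewrite ler_piMl//; have /andP[] := y01 s.
apply/ler_addgt0Pr => e e0.
have [N Ne] : exists N, N.+1%:R^-1 <= e.
  exists (Num.bound e^-1); rewrite invf_ple ?posrE//.
  apply: (le_trans (ltW (archi_boundP _))); first by rewrite invr_ge0 ltW.
  by rewrite ler_nat.
have /andP[a1 a2] := layer a A N aA; have /andP[b1 b2] := layer b B N bB.
have : `|S a N - S b N| <= tv_restr phi a b L.
  rewrite -sumrB; apply: le_trans (ler_norm_sum _ _ _) _.
  apply: (@le_trans _ _ (\sum_(j < N.+1) N.+1%:R^-1 * tv_restr phi a b L)).
    apply: ler_sum => j _; rewrite -mulrBr normrM ger0_norm ?invr_ge0//.
    by rewrite ler_wpM2l// invr_ge0.
  by rewrite sumr_const card_ord -mulrnAl -mulr_natr mulVf// mul1r.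
rewrite !ler_norml; move: a1 a2 b1 b2 Ne.
move: (S a N) (S b N) (N.+1%:R^-1) => Sa Sb i a1 a2 b1 b2 ie /andP[h1 h2].
apply/andP; split; lra.
Qed.

End TotalVariation.

Section LocalMixing.
Context {R : realType} {d : nat}.
Notation pt := (d.-tuple R).
Notation mu := (@lebd R d).
Variable phi : pt -> \bar R.
Implicit Types (a b : pt -> R) (u v : pt) (A : set pt).

Lemma integrable_indic_activity (lam : R) A (r : R) : 0 <= lam -> measurable A ->
  A `<=` cube (pt0 R d) r ->
  integrable_activity (fun x => lam * \1_A x) (lam * fine (mu A)).
Proof.
move=> lam0 mA Ar.
have Afin : mu A \is a fin_num.
  rewrite ge0_fin_numE ?measure_ge0//.
  apply: (@le_lt_trans _ _ (mu (cube (pt0 R d) `|r|))); last by rewrite lebd_cube// ltry.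
  apply: le_measure; [by rewrite inE|rewrite inE; exact: measurable_cube|].
  by move=> x /Ar h i; rewrite (le_trans (h i))// ler_norm.
have mi : measurable_fun setT (\1_A : pt -> R) by exact: measurable_indic.
split.
- exact: measurable_funM.
- by move=> x; rewrite mulr_ge0.
- under eq_integral do rewrite EFinM.
  rewrite ge0_integralZl//; first by rewrite -lebd_indic// EFinM fineK.
  exact/measurable_EFinP.
Qed.

Lemma activity_integrable a : activity a -> exists m, integrable_activity a m.
Proof.
move=> [ma [a0 [[M aM] [B aB]]]].
pose c := cube (pt0 R d) `|B|.
have [mc c0 cE] : integrable_activity (fun x => `|M| * \1_c x) (`|M| * fine (mu c)).
  apply: (@integrable_indic_activity _ _ `|B|) => //; exact: measurable_cube.
have le : (\int[mu]_x (a x)%:E <= (`|M| * fine (mu c))%:E)%E.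
  rewrite -cE; apply: ge0_le_integral => //.
  - by move=> x _; rewrite lee_fin.
  - exact/measurable_EFinP.
  - exact/measurable_EFinP.
  - move=> x _; rewrite lee_fin; have [->|ax] := eqVneq (a x) 0; first exact: c0.
    rewrite indicE mem_set ?mulr1 ?(le_trans (aM x)) ?ler_norm// => i.
    rewrite tnth_pt0 subr0 (le_trans (tnth_le_enorm x i))//.
    by rewrite (le_trans (aB x ax))// ler_norm.
exists (fine (\int[mu]_x (a x)%:E)%E); split => //; rewrite fineK//.
rewrite ge0_fin_numE; first by rewrite (le_lt_trans le)// ltry.
by apply: integral_ge0 => x _; rewrite lee_fin.
Qed.

Lemma bounded_cube v r : Defs.bounded_set (cube v r).
Proof.
exists (d%:R * (`|r| + enorm v)) => x xc.
apply: enorm_le; first by rewrite addr_ge0// (sqrtr_ge0).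
move=> i; rewrite -[tnth x i](subrK (tnth v i)) (le_trans (ler_normD _ _))//.
by rewrite lerD ?tnth_le_enorm// (le_trans (xc i))// ler_norm.
Qed.

(* Cubes rather than balls: a coordinate witness replaces the triangle
   inequality for the Euclidean norm. *)
Lemma setdist_cube v (r s : R) (B : set pt) :
  (forall y, B y -> ~ cube v s y) ->
  ((s - r)%:E <= setdist (cube v r) B)%E.
Proof.
move=> Bs; apply: le_ereal_inf_tmp => _ [x xc [y By <-]]; rewrite lee_fin.
have [i yi] : exists i, s < `|tnth y i - tnth v i|.
  apply: contrapT => /forallNP h; apply: (Bs y By) => i.
  by rewrite leNgt; apply/negP; exact: h.
apply: le_trans (tnth_le_enorm _ i); rewrite tnth_mktuple lerBlDr.
rewrite (le_trans (ltW yi))// (le_trans (ler_distD (tnth x i) _ _))//.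
by rewrite distrC lerD2l.
Qed.

(** Apply mixing with the cube of radius [r] around [v] as window, where [r] bounds the range of
    [phi]: the insertion at [v] sees nothing outside it. [C] is [alpha] times the volume of the
    window, hence the same for all [v]. *)
Lemma ssm_local lam : pair_potential phi -> strong_spatial_mixing phi lam ->
  exists C beta r : R, [/\ 0 <= C, 0 < beta &
  forall v a b (s : R), activity a -> activity b ->
    (forall x, a x <= lam) -> (forall x, b x <= lam) ->
    (forall x, cube v s x -> a x = b x) ->
    `|insertion phi a v - insertion phi b v| <= C * expR (- (beta * (s - r)))].
Proof.
move=> [mphi [_ [phi0 [r0 phir]]]] [alpha [beta [al0 [be0 ssm]]]].
pose r := `|r0|.
have r_ge0 : 0 <= r by exact: normr_ge0.
have K0 : 0 <= alpha * (2 * r) ^+ d.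
  by apply: mulr_ge0; [exact: ltW|rewrite exprn_ge0// mulr_ge0].
exists (alpha * (2 * r) ^+ d), beta, r; split => //.
move=> v a b s acta actb al bl ab.
have [A aA] := activity_integrable a acta; have [B bB] := activity_integrable b actb.
apply: le_trans (insertion_tv phi mphi phi0 a b A B v (cube v r) aA bB _) _.
  move=> x xc; apply: phir; rewrite ltNge; apply/negP => xr; apply: xc => i.
  rewrite distrC; have := tnth_le_enorm (ptsub v x) i; rewrite tnth_mktuple.
  by move=> /le_trans; apply; rewrite (le_trans xr)// ler_norm.
rewrite -lee_fin.
apply: le_trans (ssm (cube v r) a b (measurable_cube v r) (bounded_cube v r) acta actb al bl) _.
rewrite vol_cube// [leRHS]EFinM; apply: lee_wpmul2l; first by rewrite lee_fin.
rewrite -[leRHS]/(expeR (- (beta * (s - r))%:E)%E) lee_expeR leeN2 EFinM.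
apply: lee_wpmul2l; first by rewrite lee_fin ltW.
apply: setdist_cube => y /= /eqP aby yc.
by apply: aby; exact: ab.
Qed.

Lemma decay_small (C beta r e : R) : 0 <= C -> 0 < beta -> 0 < e ->
  exists s, 0 <= s /\ C * expR (- (beta * (s - r))) <= e.
Proof.
move=> C0 b0 e0; pose y := C / e.
have y0 : 0 <= y by rewrite divr_ge0// ltW.
(* This gives [beta * (s - r) >= y = C / e], and [expR y >= y] turns the bound into
   [C * expR (- y) <= e], also when [C] is 0. *)
exists (`|r| + y / beta); split; first by rewrite addr_ge0// divr_ge0// ltW.
apply: (@le_trans _ _ (C * expR (- y))).
  rewrite ler_wpM2l// ler_expR lerN2 -[leLHS](mulfVK (lt0r_neq0 b0)) mulrC.
  rewrite ler_pM2l// -addrAC lerDr subr_ge0 ler_norm//.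
rewrite expRN -ler_pdivlMr ?invr_gt0 ?expR_gt0// invrK.
rewrite mulrC -ler_pdivrMr//.
by apply: le_trans (expR_ge1Dx y); rewrite lerDr.
Qed.

End LocalMixing.

(** * The limiting insertion probability of a half-space *)

Section HalfspaceLimit.
Context {R : realType} {d : nat}.
Notation pt := (d.-tuple R).
Notation mu := (@lebd R d).
Variables (phi : pt -> \bar R) (lam : R).
Hypothesis mphi : measurable_fun setT phi.
Hypothesis phi0 : forall x, (0 <= phi x)%E.
Hypothesis lam0 : 0 < lam.
Variables (C beta r : R).
Hypotheses (C0 : 0 <= C) (beta0 : 0 < beta).
Hypothesis mixing : forall v a b (s : R), activity a -> activity b ->
  (forall x, a x <= lam) -> (forall x, b x <= lam) ->
  (forall x, cube v s x -> a x = b x) ->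
  `|insertion phi a v - insertion phi b v| <= C * expR (- (beta * (s - r))).
Variable u : pt.

Definition cst_act (A : set pt) : pt -> R := fun x => lam * \1_A x.
Definition halfspace (t : R) : set pt := [set x | t <= inner u x].

Lemma cst_act_le A x : cst_act A x <= lam.
Proof. by rewrite /cst_act ler_piMr ?(ltW lam0)// indicE lern1 leq_b1. Qed.

Lemma cst_act_activity A : measurable A -> Defs.bounded_set A -> activity (cst_act A).
Proof.
move=> mA [B AB]; split; first by apply: measurable_funM => //; exact: measurable_indic.
split; first by move=> x; rewrite mulr_ge0// ltW.
split; first by exists lam => x; exact: cst_act_le.
exists B => x /= hx; apply: AB; apply: contrapT => /(memNset (A := A)).
by move=> xA; move: hx; rewrite /cst_act indicE xA mulr0 eqxx.
Qed.

Lemma measurable_ballB n : measurable (@ballB R d n).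
Proof.
rewrite (_ : @ballB R d n = [set x | \sum_(i < d) tnth x i ^+ 2 <= n%:R ^+ 2]).
  rewrite -[X in measurable X]setTI; apply: measurable_fun_le => //.
  apply: measurable_sum => i; apply: measurable_funX; exact: measurable_tnthR.
have s0 x : 0 <= \sum_(i < d) tnth x i ^+ 2 :> R.
  by apply: sumr_ge0 => i _; rewrite sqr_ge0.
apply/seteqP; split => x; rewrite /ballB /enorm /= => h.
  by rewrite -(sqr_sqrtr (s0 x)) lerXn2r ?nnegrE ?sqrtr_ge0.
by rewrite -[leRHS]ger0_norm// -sqrtr_sqr ler_wsqrtr.
Qed.

Let q n := insertion phi (cst_act (halfspace 0 `&` @ballB R d n)) (pt0 R d).

Let aq n : activity (cst_act (halfspace 0 `&` @ballB R d n)).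
Proof.
apply: cst_act_activity.
  by apply: measurableI; [exact: measurable_halfspace|exact: measurable_ballB].
by exists n%:R => x [].
Qed.

(** The factor [d] is the crude comparison of the Euclidean norm with the sup norm in [enorm_le]. *)
Lemma cube_ballB (s : R) n : 0 <= s -> d%:R * s <= n%:R ->
  cube (pt0 R d) s `<=` @ballB R d n.
Proof.
move=> s0 sn x xs; apply: le_trans sn; apply: enorm_le => // i.
by have := xs i; rewrite tnth_pt0 subr0.
Qed.

Lemma cst_act_ballB (s : R) n : 0 <= s -> d%:R * s <= n%:R ->
  forall x, cube (pt0 R d) s x ->
  cst_act (halfspace 0 `&` @ballB R d n) x = cst_act (halfspace 0) x.
Proof.
move=> s0 sn x /(cube_ballB _ _ s0 sn) xB; rewrite /cst_act !indicE.
congr (_ * _%:R); congr nat_of_bool.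
by apply/idP/idP => /set_mem h; apply/mem_set; [case: h|split].
Qed.

(** The truncations [q n] agree with the half-space on ever larger cubes, so mixing makes them
    Cauchy. Comparing [a] with [q n] and letting [n] grow transfers the same rate to [Q], because
    that rate depends on [s] and not on [n]. *)
Lemma insertion_halfspace_limit : exists Q : R, [/\ q n @[n --> \oo] --> Q, 0 <= Q <= 1 &
  forall (s : R) a, 0 <= s -> activity a -> (forall x, a x <= lam) ->
    (forall x, cube (pt0 R d) s x -> a x = cst_act (halfspace 0) x) ->
    `|insertion phi a (pt0 R d) - Q| <= C * expR (- (beta * (s - r)))].
Proof.
have near_q (s : R) a n : 0 <= s -> d%:R * s <= n%:R -> activity a ->
    (forall x, a x <= lam) ->
    (forall x, cube (pt0 R d) s x -> a x = cst_act (halfspace 0) x) ->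
    `|insertion phi a (pt0 R d) - q n| <= C * expR (- (beta * (s - r))).
  move=> s0 sn aa al ah; apply: mixing => //; first by move=> x; exact: cst_act_le.
  by move=> x xs; rewrite ah// (cst_act_ballB _ _ s0 sn).
have bnd (s : R) : 0 <= s ->
    exists N : nat, forall n, (N <= n)%N -> d%:R * s <= n%:R.
  move=> s0; have ds0 : 0 <= d%:R * s by rewrite mulr_ge0.
  exists (Num.bound (d%:R * s)) => n Nn.
  by apply: (le_trans (ltW (archi_boundP ds0))); rewrite ler_nat.
have cvq : cvg (q n @[n --> \oo]).
  apply: cauchy_cvg; apply: cauchy_exP => e e0.
  have [s [s0 hs]] := decay_small C beta r (e / 2) C0 beta0 (divr_gt0 e0 (ltr0Sn _ 1)).
  have [N hN] := bnd s s0.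
  exists (q N); exists N => // n /= Nn; rewrite /ball/=.
  apply: (@le_lt_trans _ _ (e / 2)); last by rewrite ltr_pdivrMr// ltr_pMr// ltr1n.
  apply: le_trans hs; apply: near_q => //; first exact: hN.
    by move=> x; exact: cst_act_le.
  by apply: cst_act_ballB => //; exact: hN.
have q01 n : 0 <= q n <= 1.
  have [m am] := activity_integrable _ (aq n).
  by rewrite (insertion_ge0 phi mphi phi0 _ _ am) (insertion_le1 phi mphi phi0 _ _ am).
exists (lim (q n @[n --> \oo])); split => //.
  apply/andP; split.
    by apply: limr_ge => //; apply: nearW => n; case/andP: (q01 n).
  by apply: limr_le => //; apply: nearW => n; case/andP: (q01 n).
move=> s a s0 aa al ah; apply/ler_addgt0Pr => e e0.
have [N hN] := bnd s s0.
have /cvgrPdist_le/(_ e e0) [M _ hM] := cvq.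
pose n := maxn N M.
apply: (le_trans (ler_distD (q n) _ _)); apply: lerD.
  by apply: near_q => //; apply: hN; rewrite leq_maxl.
by rewrite distrC; apply: hM => /=; rewrite leq_maxr.
Qed.

End HalfspaceLimit.

(** * Filling a box slab by slab *)

Section LogIncrement.
Context {R : realType}.

(** From [- ln (1 - K) <= K / (1 - K)]. The denominator is relaxed to [1 - h], common to all slabs,
    so that the bounds are linear in [K] and can be summed. *)
Lemma ln_incr_upper (x y K h : R) : 0 < x -> 0 < y -> 0 <= K -> K <= h -> h < 1 ->
  y * (1 - K) <= x -> ln y - ln x <= K / (1 - h).
Proof.
move=> x0 y0 K0 Kh h1 yx.
have K1 : 0 < 1 - K by lra.
have h1' : 0 < 1 - h by lra.
apply: (@le_trans _ _ (K / (1 - K))); last first.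
  by rewrite ler_wpM2l// lef_pV2 ?posrE//; lra.
have : ln (y * (1 - K)) <= ln x by rewrite ler_ln ?posrE// mulr_gt0.
rewrite lnM ?posrE// => hl.
have K3 : -1 < K / (1 - K) by rewrite (lt_le_trans (ltrN10 _))// divr_ge0// ltW.
have := le_ln1Dx K3; rewrite (_ : 1 + _ = (1 - K)^-1); last first.
  by field; rewrite gt_eqF.
rewrite lnV ?posrE//; lra.
Qed.

(** The counterpart, from [ln (1 + K) >= K / (1 + K)]. *)
Lemma ln_incr_lower (x y K h : R) : 0 < x -> 0 < y -> 0 <= K -> K <= h ->
  x * (1 + K) <= y -> K / (1 + h) <= ln y - ln x.
Proof.
move=> x0 y0 K0 Kh xy.
have K1 : 0 < 1 + K by lra.
have h1' : 0 < 1 + h by lra.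
apply: (@le_trans _ _ (K / (1 + K))).
  by rewrite ler_wpM2l// lef_pV2 ?posrE//; lra.
have : ln (x * (1 + K)) <= ln y by rewrite ler_ln ?posrE// mulr_gt0.
rewrite lnM ?posrE// => hl.
have K3 : -1 < - (K / (1 + K)) by rewrite ltrN2 ltr_pdivrMr// mul1r; lra.
have := le_ln1Dx K3; rewrite (_ : 1 + _ = (1 + K)^-1); last first.
  by field; rewrite gt_eqF.
rewrite lnV ?posrE//; lra.
Qed.

End LogIncrement.

Section SlabInduction.
Context {R : realType} {d : nat}.
Notation pt := (d.-tuple R).
Notation mu := (@lebd R d).
Variables (phi : pt -> \bar R) (lam : R).
Hypothesis mphi : measurable_fun setT phi.
Hypothesis phi0 : forall x, (0 <= phi x)%E.
Hypothesis phiN : forall x, phi (ptopp x) = phi x.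
Hypothesis lam0 : 0 < lam.
Variables (u : pt) (Q e0 s : R).
Hypothesis u1 : \sum_(i < d) tnth u i ^+ 2 = 1.
Hypothesis Q01 : 0 <= Q <= 1.
Hypotheses (e00 : 0 <= e0) (s0 : 0 <= s).
Notation cst_act := (cst_act lam).
Notation halfspace := (halfspace u).

(** Translation by [v] carries the half-space at height [inner u v] to the one at height 0, so a
    single [Q], [e0] and [s] serve all points. *)
Lemma insertion_halfspace_translate :
  (forall a, activity a -> (forall x, a x <= lam) ->
    (forall x, cube (pt0 R d) s x -> a x = cst_act (halfspace 0) x) ->
    `|insertion phi a (pt0 R d) - Q| <= e0) ->
  forall v a, activity a -> (forall x, a x <= lam) ->
    (forall x, cube v s x -> a x = cst_act (halfspace (inner u v)) x) ->
    `|insertion phi a v - Q| <= e0.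
Proof.
move=> near0 v a [ma [a0 [[M aM] [B aB]]]] al ah.
rewrite (insertion_shift phi mphi a v)//; apply: near0 => //.
- split; first exact: (measurableT_comp ma (measurable_ptadd v)).
  split => //; split; first by exists M.
  exists (d%:R * (`|B| + enorm v)) => x /= /aB hx.
  apply: enorm_le; first by rewrite addr_ge0// sqrtr_ge0.
  move=> i; have := tnth_le_enorm (ptadd d x v) i; rewrite tnth_mktuple => h.
  rewrite -[tnth x i](addrK (tnth v i)) (le_trans (ler_normB _ _))//.
  by rewrite lerD ?tnth_le_enorm// (le_trans h)// (le_trans hx)// ler_norm.
- move=> x xs; rewrite ah; last first.
    by move=> i; have := xs i; rewrite tnth_pt0 subr0 tnth_mktuple addrK.
  rewrite /cst_act !indicE; congr (_ * _%:R); congr nat_of_bool.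
  by apply/idP/idP => /set_mem h; apply/mem_set; move: h;
    rewrite /halfspace/= inner_ptadd; lra.
Qed.

Hypothesis near_halfspace : forall v a, activity a -> (forall x, a x <= lam) ->
  (forall x, cube v s x -> a x = cst_act (halfspace (inner u v)) x) ->
  `|insertion phi a v - Q| <= e0.

Variables (rho sig : R).
Hypotheses (sig0 : 0 <= sig) (sig_rho : sig + s <= rho).
(** Every point of the inner cube [Lam'] has its mixing cube of radius [s] inside the box [Lam]. The
    difference of the two is the boundary layer. *)
Let Lam : set pt := cube (pt0 R d) rho.
Let Lam' : set pt := cube (pt0 R d) sig.
Let Act t := cst_act (Lam `&` halfspace t).
Let mLam : measurable Lam := measurable_cube _ _.
Let mLam' : measurable Lam' := measurable_cube _ _.
Let strip (t' t : R) : set pt := slab u t' (t - t').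

Lemma stripE t' t x : strip t' t x = (t' <= inner u x < t) :> Prop.
Proof. by rewrite /strip /slab/= addrC subrK. Qed.

Let mstrip t' t : measurable (strip t' t) := measurable_slab _ _ _.

Let mass (A : set pt) := fine (mu A).

Let Lam'_sub : Lam' `<=` Lam.
Proof. by move=> x h i; rewrite (le_trans (h i))// (le_trans _ sig_rho)// lerDl. Qed.

Let fin_sub (A : set pt) : measurable A -> A `<=` Lam -> mu A \is a fin_num.
Proof.
move=> mA AL; rewrite ge0_fin_numE ?measure_ge0//.
apply: (@le_lt_trans _ _ (mu Lam)).
  by apply: le_measure; rewrite ?inE.
by rewrite lebd_cube ?ltry// (le_trans _ sig_rho)// addr_ge0.
Qed.

Lemma le_mass (A B : set pt) : measurable A -> measurable B -> A `<=` B ->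
  B `<=` Lam -> mass A <= mass B.
Proof.
move=> mA mB AB BL; apply: fine_le; [|exact: fin_sub|].
  by apply: fin_sub => // x /AB /BL.
by apply: le_measure; rewrite ?inE.
Qed.

Lemma mass_halfspace (A : set pt) t' t : measurable A -> A `<=` Lam -> t' <= t ->
  mass (A `&` halfspace t') = mass (A `&` halfspace t) + mass (A `&` strip t' t).
Proof.
move=> mA AL tt.
have mh t1 : measurable (A `&` halfspace t1).
  by apply: measurableI => //; exact: measurable_halfspace.
have ms : measurable (A `&` strip t' t) by exact: measurableI.
rewrite /mass -fineD; [|by apply: fin_sub => // x []; auto|by apply: fin_sub => // x []; auto].
congr fine; rewrite -measureU//.
- congr (mu _); apply/seteqP; split => x /=.
    move=> [Ax h]; have [h'|h'] := leP t (inner u x); [by left|right].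
    by split => //; rewrite stripE h h'.
  by rewrite stripE => -[[Ax h]|[Ax /andP[h _]]]; split => //; exact: le_trans h.
- apply/seteqP; split => // x /=; rewrite stripE => -[[_ h] [_ /andP[_]]].
  by rewrite ltNge h.
Qed.

Lemma Act_split t' t : t' <= t ->
  Act t' = (fun x => Act t x + cst_act (Lam `&` strip t' t) x).
Proof.
move=> tt; apply/funext => x; rewrite /Act /cst_act -mulrDr; congr (_ * _).
rewrite !indicE -natrD; congr (_%:R).
have [Lx|Lx] := boolP (x \in Lam); last first.
  have nL B : (x \in Lam `&` B) = false.
    by apply/negbTE; apply: contra Lx => /set_mem[h _]; exact/mem_set.
  by rewrite !nL.
have LI B : (x \in Lam `&` B) = (x \in B).
  by apply/idP/idP => /set_mem h; apply/mem_set; [case: h|split => //; exact: set_mem].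
rewrite !LI.
have -> : (x \in halfspace t') = (t' <= inner u x) by apply/idP/idP => [/set_mem//|h]; apply/mem_set.
have -> : (x \in halfspace t) = (t <= inner u x) by apply/idP/idP => [/set_mem//|h]; apply/mem_set.
have -> : (x \in strip t' t) = (t' <= inner u x < t).
  by apply/idP/idP => [/set_mem|h]; [rewrite stripE|apply/mem_set; rewrite stripE].
have [h|h] := leP t (inner u x); first by rewrite (le_trans tt h).
by rewrite andbT add0n.
Qed.

Lemma cst_act_integrable (A : set pt) : measurable A -> A `<=` Lam ->
  integrable_activity (cst_act A) (lam * mass A).
Proof. by move=> mA AL; apply: integrable_indic_activity AL => //; exact: ltW. Qed.

Let mLH t : measurable (Lam `&` halfspace t).
Proof. by apply: measurableI => //; exact: measurable_halfspace. Qed.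

Let mLS t' t : measurable (Lam `&` strip t' t).
Proof. exact: measurableI. Qed.

Lemma Act_integrable t : integrable_activity (Act t) (lam * mass (Lam `&` halfspace t)).
Proof. exact: cst_act_integrable. Qed.

Lemma strip_integrable t' t :
  integrable_activity (cst_act (Lam `&` strip t' t)) (lam * mass (Lam `&` strip t' t)).
Proof. exact: cst_act_integrable. Qed.

Lemma insertion_Act_lipschitz t' t v : t' <= t ->
  `|insertion phi (Act t') v - insertion phi (Act t) v| <= lam * mass (Lam `&` strip t' t).
Proof.
move=> tt; rewrite (Act_split _ _ tt).
exact: (insertion_lipschitz phi mphi phi0 phiN _ _ _ _ (Act_integrable t) (strip_integrable t' t)).
Qed.

Lemma insertion_Act_near v : Lam' v -> `|insertion phi (Act (inner u v)) v - Q| <= e0.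
Proof.
move=> vL; apply: near_halfspace.
- apply: cst_act_activity => //.
  by have [M hM] := bounded_cube (pt0 R d) rho; exists M => x [/hM].
- by move=> x; exact: cst_act_le.
- move=> x xv; rewrite /Act /cst_act; congr (_ * _).
  rewrite !indicE; congr (_%:R); congr nat_of_bool.
  apply/idP/idP => /set_mem h; apply/mem_set; first by case: h.
  split => // i; rewrite tnth_pt0 subr0 -[tnth x i](subrK (tnth v i)).
  rewrite (le_trans (ler_normD _ _))// (le_trans _ sig_rho)// addrC lerD//.
  by have := vL i; rewrite tnth_pt0 subr0.
Qed.

Section Step.
Variables (t' t h : R).
Hypothesis tt : t' <= t.
Hypothesis massh : lam * mass (Lam `&` strip t' t) <= h.
Hypothesis h1 : h < 1.

Let m0 : 0 <= lam * mass (Lam `&` strip t' t).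
Proof. by apply: mulr_ge0; [exact: ltW|exact: fine_ge0]. Qed.

Let sub_mass w1 w2 : t' <= w1 -> w2 <= t -> lam * mass (Lam `&` strip w1 w2) <= h.
Proof.
move=> tw wt; apply: le_trans massh; rewrite ler_pM2l//; apply: le_mass => //.
by move=> x [Lx]; rewrite stripE => /andP[a b]; split => //; rewrite stripE; apply/andP; split; lra.
Qed.

(** The height of [v] lies between [t'] and [t]. At that very height the activity is exactly a
    half-space near [v]; passing from there to either end adds or removes part of the strip, of mass
    at most [h]. The end [t] serves the lower bound on the increment, [t'] the upper one. *)
Lemma insertion_deep v : Lam' v -> strip t' t v ->
  `|insertion phi (Act t) v - Q| <= e0 + h /\ `|insertion phi (Act t') v - Q| <= e0 + h.
Proof.
move=> vL; rewrite stripE => /andP[v1 v2].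
have near := insertion_Act_near v vL.
have l1 := insertion_Act_lipschitz _ _ v (ltW v2); have l2 := insertion_Act_lipschitz _ _ v v1.
have k1 := sub_mass _ _ v1 (lexx t); have k2 := sub_mass _ _ (lexx t') (ltW v2).
move: near l1 l2; rewrite !ler_norml => /andP[? ?] /andP[? ?] /andP[? ?].
by split; apply/andP; split; lra.
Qed.

Let Lb := Lam `\` Lam'.
Let mLb : measurable Lb := measurableD mLam mLam'.
Let Lb_sub : Lb `<=` Lam. Proof. by move=> x []. Qed.
Let AtE := Act_split _ _ tt.

Lemma lnZ_step_upper :
  ln (Zr phi (Act t')) - ln (Zr phi (Act t)) <=
  lam / (1 - h) * ((Q + (e0 + h)) * mass (Lam' `&` strip t' t) +
                   mass (Lb `&` strip t' t)).
Proof.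
have /andP[Q0 Q1] := Q01.
have [mS S0 SE] := strip_integrable t' t.
have aA := Act_integrable t'.
have Z' := Zr_gt0 phi mphi phi0 _ _ aA.
have Z := Zr_gt0 phi mphi phi0 _ _ (Act_integrable t).
pose g v := cst_act (Lam `&` strip t' t) v * insertion phi (Act t') v.
have g0 v : 0 <= g v by rewrite mulr_ge0// (insertion_ge0 phi mphi phi0 _ _ aA).
have mg : measurable_fun setT (EFin \o g).
  by apply/measurable_EFinP; apply: measurable_funM => //; exact: (measurable_insertion phi mphi phi0 _ _ aA).
have gle : (\int[mu]_v (g v)%:E <= (lam * mass (Lam `&` strip t' t))%:E)%E.
  have := insertion_mass phi mphi phi0 _ _ _ _ (Act_integrable t) (strip_integrable t' t).
  by rewrite -AtE.
have gfin : (\int[mu]_v (g v)%:E)%E \is a fin_num.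
  rewrite ge0_fin_numE; first by rewrite (le_lt_trans gle)// ltry.
  by apply: integral_ge0 => v _; rewrite lee_fin.
pose K := fine (\int[mu]_v (g v)%:E)%E.
have KE : (\int[mu]_v (g v)%:E)%E = K%:E by rewrite fineK.
have K0 : 0 <= K by apply: fine_ge0; apply: integral_ge0 => v _; rewrite lee_fin.
have Kh : K <= h by apply: le_trans massh; rewrite -lee_fin -KE.
set c := Q + (e0 + h); set X := _ + mass _.
have h0 : 0 <= h := le_trans m0 massh.
have c0 : 0 <= c by rewrite /c !addr_ge0.
have mS' : measurable (Lam' `&` strip t' t) by exact: measurableI.
have mS'' : measurable (Lb `&` strip t' t) by exact: measurableI.
(* The dominating density is [lam * c] on the part of the strip in [Lam'] and [lam] on the part in
   the boundary layer, where the insertion probability is only known to be at most 1. *)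
have [_ _ XE] := integrable_activityD _ _ _ _
  (integrable_indic_activity (lam * c) _ _ (mulr_ge0 (ltW lam0) c0) mS' (subset_trans (@subIsetl _ _ _) Lam'_sub))
  (cst_act_integrable _ mS'' (subset_trans (@subIsetl _ _ _) Lb_sub)).
have KX : K <= lam * X.
  rewrite -lee_fin -KE /X mulrDr mulrA -XE; apply: ge0_le_integral => //.
  - by move=> v _; rewrite lee_fin.
  - apply/measurable_EFinP; apply: measurable_funD; apply: measurable_funM => //;
      exact: measurable_indic.
  - move=> v _; rewrite lee_fin /g /cst_act.
    have [vS|vS] := boolP (v \in Lam `&` strip t' t); last first.
      by rewrite indicE (negbTE vS) mulr0 mul0r addr_ge0// mulr_ge0// ?mulr_ge0// ltW.
    have [vL vs] := set_mem vS.
    rewrite indicE vS mulr1.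
    have [vL'|vL'] := pselect (Lam' v).
      have [_ /ler_normlP[_ near]] := insertion_deep v vL' vs.
      have i1 : v \in Lam' `&` strip t' t by apply/mem_set.
      have i2 : (v \in Lb `&` strip t' t) = false.
        by apply: memNset => -[[_]].
      by rewrite !indicE i1 i2 mulr0 addr0 mulr1 ler_pM2l// /c; lra.
    have i1 : (v \in Lam' `&` strip t' t) = false by apply: memNset => -[].
    have i2 : v \in Lb `&` strip t' t by apply/mem_set.
    rewrite !indicE i1 i2 mulr0 add0r mulr1 ler_piMr ?(ltW lam0)//.
    exact: (insertion_le1 phi mphi phi0 _ _ aA).
apply: (@le_trans _ _ (K / (1 - h))).
  apply: ln_incr_upper => //.
  have := Zr_incr_upper phi mphi phi0 phiN _ _ _ _ (Act_integrable t) (strip_integrable t' t) K.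
  by rewrite -AtE; apply; rewrite -KE.
have h1' : 0 < 1 - h by rewrite subr_gt0.
by rewrite mulrAC ler_wpM2r// invr_ge0 ltW.
Qed.

(** The boundary layer is dropped, its contribution being nonnegative. The maximum with 0 keeps [qm]
    a valid lower bound for the insertion probability when [Q] is smaller than the error. *)
Lemma lnZ_step_lower (qm : R) : 0 <= qm -> qm <= Num.max 0 (Q - (e0 + h)) ->
  lam / (1 + h) * (qm * mass (Lam' `&` strip t' t)) <=
  ln (Zr phi (Act t')) - ln (Zr phi (Act t)).
Proof.
move=> qm0 qmQ.
have h0 : 0 <= h := le_trans m0 massh.
have /andP[Q0 Q1] := Q01.
have qm1 : qm <= 1 by apply: (le_trans qmQ); rewrite ge_max ler01/= lerBlDr (le_trans Q1)// lerDl addr_ge0.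
have mS' : measurable (Lam' `&` strip t' t) by exact: measurableI.
have S'0 : 0 <= mass (Lam' `&` strip t' t) by exact: fine_ge0.
have [_ _ KE] := integrable_indic_activity (lam * qm) _ _
  (mulr_ge0 (ltW lam0) qm0) mS' (subset_trans (@subIsetl _ _ _) Lam'_sub).
have aA := Act_integrable t.
have [mS S0 SE] := strip_integrable t' t.
have Z' := Zr_gt0 phi mphi phi0 _ _ (Act_integrable t').
have Z := Zr_gt0 phi mphi phi0 _ _ aA.
pose K := lam * qm * mass (Lam' `&` strip t' t).
have K0 : 0 <= K by rewrite /K !mulr_ge0// ltW.
have Kh : K <= h.
  apply: le_trans massh; rewrite /K -mulrA ler_pM2l// -[leRHS]mul1r ler_pM//.
  by apply: le_mass => // x [/Lam'_sub].
have hK : (K%:E <= \int[mu]_v (cst_act (Lam `&` strip t' t) v * insertion phi (Act t) v)%:E)%E.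
  rewrite /K /mass -KE; apply: ge0_le_integral => //.
  - by move=> v _; rewrite lee_fin !mulr_ge0// ltW.
  - apply/measurable_EFinP; apply: measurable_funM => //; exact: measurable_indic.
  - apply/measurable_EFinP; apply: measurable_funM => //.
    exact: (measurable_insertion phi mphi phi0 _ _ aA).
  - move=> v _; rewrite lee_fin indicE.
    have [vS|vS] := boolP (v \in Lam' `&` strip t' t); last first.
      by rewrite mulr0 mulr_ge0// (insertion_ge0 phi mphi phi0 _ _ aA).
    have [vL' vs] := set_mem vS.
    rewrite /cst_act indicE mem_set; last by split => //; exact: Lam'_sub.
    rewrite !mulr1 ler_pM2l// (le_trans qmQ)// ge_max.
    rewrite (insertion_ge0 phi mphi phi0 _ _ aA)/=.
    by have [/ler_normlP[near _] _] := insertion_deep v vL' vs; lra.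
apply: (@le_trans _ _ (K / (1 + h))).
  by rewrite mulrAC /K mulrA.
apply: ln_incr_lower => //; rewrite AtE.
exact: (Zr_incr_lower phi mphi phi0 phiN _ _ _ _ (Act_integrable t) (strip_integrable t' t) K hK).
Qed.

End Step.

Lemma mass_split : mass Lam = mass Lam' + mass (Lam `\` Lam').
Proof.
have mD : measurable (Lam `\` Lam') by exact: measurableD.
rewrite /mass -fineD; [|exact: fin_sub|by apply: fin_sub => // x []].
congr fine; rewrite -measureU//; first by rewrite setDUK.
by rewrite setDE setICA setICr setI0.
Qed.

Lemma inner_bound x : Lam x -> `|inner u x| <= d%:R * rho.
Proof.
move=> xL; apply: (le_trans (ler_norm_sum _ _ _)).
apply: (@le_trans _ _ (\sum_(i < d) rho)); last by rewrite sumr_const card_ord mulr_natl.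
apply: ler_sum => i _; rewrite normrM -[leRHS]mul1r ler_pM//.
  by rewrite (le_trans (tnth_le_enorm u i))// /enorm u1 sqrtr1.
by have := xL i; rewrite tnth_pt0 subr0.
Qed.

Lemma Zr_hact0 : Zr phi (cst_act set0) = 1.
Proof.
have i0 : integrable_activity (cst_act (set0 : set pt)) 0.
  by have := cst_act_integrable set0 measurable0 (@sub0set _ _); rewrite /mass measure0 /= mulr0.
apply/eqP; rewrite eq_le (Zr_ge1 phi mphi phi0 _ _ i0) andbT.
by rewrite -lee_fin -(ZrE phi mphi phi0 _ _ i0) -expR0; exact: Zpart_le_exp.
Qed.

(** The step bounds telescope: they are linear in the masses of the strips, which add up to the
    masses of [Lam'] and of the boundary layer. The number of slabs therefore disappears from the
    result. *)
Lemma lnZ_sandwich (h qm : R) : 0 < h -> h < 1 ->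
  0 <= qm -> qm <= Num.max 0 (Q - (e0 + h)) ->
  lam / (1 + h) * (qm * mass Lam') <= ln (Zr phi (cst_act Lam)) <=
  lam / (1 - h) * ((Q + (e0 + h)) * mass Lam' + mass (Lam `\` Lam')).
Proof.
move=> h0 h1 qm0 qmQ.
have rho0 : 0 <= rho by rewrite (le_trans _ sig_rho)// addr_ge0.
(* [V / M] is the bound of [slab_mass] for a slab of width [1/M] in the box; [M] is taken so large
   that this slab carries activity at most [h]. *)
pose V := (2 * (rho + 1)) ^+ d.
have V0 : 0 <= V by rewrite exprn_ge0// mulr_ge0// addr_ge0.
pose M := (Num.bound (lam * V / h)).+1.
have M0 : 0 < M%:R :> R by rewrite ltr0n.
have MV : lam * (V / M%:R) <= h.
  rewrite mulrA ler_pdivrMr// [leRHS]mulrC -ler_pdivrMr//.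
  have b0 : 0 <= lam * V / h by rewrite divr_ge0 ?mulr_ge0// ltW.
  by apply: (le_trans (ltW (archi_boundP b0))); rewrite ler_nat.
(* On the box [inner u] is at most [d * rho] in absolute value; the extra 1 makes the half-space at
   the starting height miss the box entirely. *)
pose T := d%:R * rho + 1.
pose t j := T - j%:R / M%:R.
have tS j : t j.+1 = t j - M%:R^-1.
  by rewrite /t -natr1 mulrDl mul1r opprD addrA.
have tle j : t j.+1 <= t j by rewrite tS gerBl invr_ge0 ltW.
have sm j : lam * mass (Lam `&` strip (t j.+1) (t j)) <= h.
  apply: le_trans MV; rewrite ler_pM2l// -lee_fin fineK; last first.
    by apply: fin_sub => // x [].
  rewrite /strip (_ : t j - t j.+1 = M%:R^-1); last by rewrite tS opprB addrC subrK.
  by rewrite setIC; apply: slab_mass.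
have Ttop (A : set pt) : A `<=` Lam -> A `&` halfspace (t 0%N) = set0.
  move=> AL; apply/seteqP; split => // x [/AL/inner_bound xb].
  rewrite /halfspace/= /t mul0r subr0 /T => h2.
  have := le_trans (ler_norm _) xb; lra.
have mh (A : set pt) j : measurable A -> measurable (A `&` halfspace (t j)).
  by move=> mA; apply: measurableI => //; exact: measurable_halfspace.
have mLb : measurable (Lam `\` Lam') by exact: measurableD.
have Lb_sub : Lam `\` Lam' `<=` Lam by move=> x [].
(* The induction starts from the zero activity, whose partition function is 1, so both sides vanish
   at [j = 0]. *)
have low j : lam / (1 + h) * (qm * mass (Lam' `&` halfspace (t j))) <=
    ln (Zr phi (Act (t j))).
  elim: j => [|j IH].
    by rewrite Ttop// /Act Ttop// Zr_hact0 ln1 /mass measure0 /= !mulr0.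
  have := lnZ_step_lower _ _ _ (tle j) (sm j) qm qm0 qmQ.
  rewrite (mass_halfspace _ _ _ mLam' Lam'_sub (tle j)) !mulrDr; lra.
have upp j : ln (Zr phi (Act (t j))) <=
    lam / (1 - h) * ((Q + (e0 + h)) * mass (Lam' `&` halfspace (t j)) +
                     mass ((Lam `\` Lam') `&` halfspace (t j))).
  elim: j => [|j IH].
    by rewrite !Ttop// /Act Ttop// Zr_hact0 ln1 /mass measure0 /= !mulr0 addr0 mulr0.
  have := lnZ_step_upper _ _ _ (tle j) (sm j) h1.
  rewrite (mass_halfspace _ _ _ mLam' Lam'_sub (tle j)).
  rewrite (mass_halfspace _ _ _ mLb Lb_sub (tle j)).
  move: IH; rewrite !mulrDr; lra.
have T0 : 0 <= T by rewrite addr_ge0// mulr_ge0.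
(* [J / M] is an integer above [2 * T], so [J] steps of length [1/M] descend from [T] to below
   [- T]. *)
pose J := (Num.bound (2 * T) * M)%N.
have tJ : t J <= - T.
  rewrite /t /J natrM mulfK ?gt_eqF// lerBlDl -lerBlDr opprK.
  have T20 : 0 <= 2 * T by rewrite mulr_ge0.
  by have := archi_boundP T20; lra.
have Tbot (A : set pt) : A `<=` Lam -> A `&` halfspace (t J) = A.
  move=> AL; apply/seteqP; split => [x []//|x Ax]; split => //.
  have := inner_bound x (AL _ Ax); rewrite /halfspace/= ler_norml => /andP[xb _].
  by apply: (le_trans tJ); rewrite (le_trans _ xb)// lerN2 lerDl.
by have := low J; have := upp J; rewrite /Act !Tbot// => -> ->.
Qed.

End SlabInduction.

(** * Elementary inequalities for the final squeeze *)

Section LimitBounds.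
Context {R : realType}.

(** Used with [x = k / n], where [(1 - x) ^+ d] is the share of the box occupied by the inner
    cube. *)
Lemma bernoulli_lower (x : R) n : 0 <= x <= 1 -> 1 - n%:R * x <= (1 - x) ^+ n.
Proof.
move=> /andP[x0 x1]; elim: n => [|n IH]; first by rewrite mul0r subr0 expr0.
rewrite exprS; apply: (@le_trans _ _ ((1 - x) * (1 - n%:R * x))); last first.
  by rewrite ler_wpM2l// subr_ge0.
have : 0 <= n%:R * x * x by rewrite !mulr_ge0.
rewrite -natr1; lra.
Qed.

(** [th] is the volume share of the inner cube. The numerator is at most [Q + 3 * h], and clearing
    the denominator costs [Q * h <= h] and [8 * h * h <= 4 * h]; the constant 8 just covers 3 + 1 +
    4. *)
Lemma squeeze_upper (Q h th : R) : 0 <= Q <= 1 -> 0 < h -> h <= 1 / 2 ->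
  1 - h <= th -> th <= 1 ->
  ((Q + (h + h)) * th + (1 - th)) / (1 - h) <= Q + 8 * h.
Proof.
move=> /andP[Q0 Q1] h0 h2 th0 th1.
have h1 : 0 < 1 - h by lra.
rewrite ler_pdivrMr//.
have q1 : (Q + (h + h)) * th <= Q + (h + h) by rewrite ler_piMr//; lra.
have q2 : Q * h <= h by rewrite ler_piMl// ltW.
have q3 : h * h <= h / 2 by rewrite ler_pM2l//; lra.
have -> : (Q + 8 * h) * (1 - h) = Q + 8 * h - Q * h - 8 * (h * h) by ring.
lra.
Qed.

Lemma squeeze_lower (Q h th : R) : 0 <= Q <= 1 -> 0 < h -> h <= 1 / 2 ->
  1 - h <= th -> th <= 1 ->
  Q - 8 * h <= Num.max 0 (Q - (h + h)) * th / (1 + h).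
Proof.
move=> /andP[Q0 Q1] h0 h2 th0 th1.
set q := Num.max 0 _.
have q0 : 0 <= q by rewrite le_max lexx.
have qQ : Q - (h + h) <= q by rewrite le_max lexx orbT.
have q1 : q <= 1 by rewrite ge_max ler01/=; lra.
have h1 : 0 < 1 + h by lra.
rewrite ler_pdivlMr//.
have p1 : q * (1 - h) <= q * th by rewrite ler_wpM2l.
have p2 : q * h <= h by rewrite ler_piMl// ltW.
have p3 : Q * h <= h by rewrite ler_piMl// ltW.
have p4 : 0 <= h * h by rewrite mulr_ge0// ltW.
have -> : (Q - 8 * h) * (1 + h) = Q + Q * h - 8 * h - 8 * (h * h) by ring.
move: p1; rewrite mulrBr mulr1; lra.
Qed.

End LimitBounds.

Lemma halfspace_act_ballB {R : realType} {d : nat} (lam : R) (u : d.-tuple R) n :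
  (fun x => halfspace_act lam u x * \1_(@ballB R d n) x) =
  cst_act lam (halfspace u 0 `&` @ballB R d n).
Proof.
apply/funext => x; rewrite /cst_act /halfspace_act indicI/= mulrA; congr (_ * _).
have -> : \1_(halfspace u 0) x = (0 <= inner u x)%R%:R :> R.
  by rewrite indicE; congr (nat_of_bool _)%:R; apply/idP/idP => [/set_mem|h]; last exact/mem_set.
by case: ifP; rewrite ?mulr1 ?mulr0.
Qed.

Theorem theorem3 (R : realType) (d : nat) (phi : d.-tuple R -> \bar R) (lam : R) :
  pair_potential phi -> 0 < lam -> strong_spatial_mixing phi lam ->
  forall u : d.-tuple R, \sum_(i < d) tnth u i ^+ 2 = 1 ->
  exists p : R,
    (fun n : nat => ln (fine (Zpart phi (fun x => lam * \1_(@boxL R d n) x)))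
                    / vol (@boxL R d n)) @ \oo --> p /\
    (fun n : nat => rho phi (fun x => halfspace_act lam u x * \1_(@ballB R d n) x)
                        (pt0 R d)) @ \oo --> p.
Proof.
move=> phiP lam0 ssm u u1; have [mphi [phiN [phi0 _]]] := phiP.
have [C [beta [r [C0 beta0 mix]]]] := ssm_local phi lam phiP ssm.
have [Q [cvQ Q01 nearQ]] := insertion_halfspace_limit phi lam mphi phi0 lam0 C beta r C0 beta0 mix u.
(* The common limit: the density at the origin is the activity there times the limiting insertion
   probability. *)
exists (lam * Q); split; last first.
  rewrite (_ : (fun n => rho _ _ _) = (fun n =>
      lam * insertion phi (cst_act lam (halfspace u 0 `&` @ballB R d n)) (pt0 R d))); last first.
    apply/funext => n; rewrite halfspace_act_ballB /rho; congr (_ * _).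
    (* The origin lies on the boundary of the closed half-space and in every ball, so its activity
       is [lam]. *)
    rewrite /cst_act indicE mem_set ?mulr1//; split.
      rewrite /halfspace/= /inner big1// => i _; by rewrite tnth_pt0 mulr0.
    rewrite /ballB/= /enorm big1 ?sqrtr0// => i _; by rewrite tnth_pt0 expr0n.
  exact: cvgMr.
apply/cvgrPdist_le => e e0.
(* The final error is [8 * lam * h], to be at most [e]; the bound [1 / 2] is required by the squeeze
   lemmas. *)
pose h := Num.min (1 / 2) (e / (8 * lam)).
have h0 : 0 < h by rewrite lt_min !divr_gt0// mulr_gt0.
have h2 : h <= 1 / 2 by rewrite ge_min lexx.
have he : lam * (8 * h) <= e.
  have : h <= e / (8 * lam) by rewrite ge_min lexx orbT.
  rewrite ler_pdivlMr ?mulr_gt0//; congr (_ <= _); ring.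
have h1 : h < 1 by lra.
have [s [s0 hs]] := decay_small C beta r h C0 beta0 h0.
have near0 a : activity a -> (forall x, a x <= lam) ->
    (forall x, cube (pt0 R d) s x -> a x = cst_act lam (halfspace u 0) x) ->
    `|insertion phi a (pt0 R d) - Q| <= h.
  by move=> aa al ah; apply: le_trans hs; exact: nearQ.
have near_all := insertion_halfspace_translate phi lam mphi u Q h s near0.
(* [k] is the width of the boundary layer: at least the mixing radius, and fixed while the box
   grows. *)
pose k := Num.bound s.
have sk : s <= k%:R by exact/ltW/archi_boundP.
(* The second term ensures [d * (k / n) <= h], hence a volume share of at least [1 - h] by
   Bernoulli's inequality; the first leaves room for the inner cube. The successor taken next gives
   [k < n], so [n] is positive. *)
pose N := maxn k (Num.bound (d%:R * k%:R / h)).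
exists N.+1 => // n /= Nn.
have kn : (k < n)%N by apply: leq_trans Nn; rewrite ltnS leq_maxl.
have n0 : 0 < n%:R :> R by rewrite ltr0n (leq_ltn_trans _ kn).
pose x : R := k%:R / n%:R.
have x01 : 0 <= x <= 1.
  by rewrite /x divr_ge0//= ler_pdivrMr// mul1r ler_nat ltnW.
have dx : d%:R * x <= h.
  rewrite /x mulrA ler_pdivrMr// [leRHS]mulrC -ler_pdivrMr//.
  have b0 : 0 <= d%:R * k%:R / h by rewrite divr_ge0 ?mulr_ge0// ltW.
  apply: (le_trans (ltW (archi_boundP b0))); rewrite ler_nat.
  by rewrite (leq_trans _ (ltnW Nn))// leq_maxr.
pose th := (1 - x) ^+ d.
have th0 : 1 - h <= th.
  by apply: le_trans (bernoulli_lower x d x01); rewrite lerD2l lerN2.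
have /andP[x0 x1] := x01.
have th1 : th <= 1 by rewrite exprn_ile1// ?subr_ge0// gerBl.
pose sig : R := n%:R - k%:R.
have sig0 : 0 <= sig by rewrite subr_ge0 ler_nat ltnW.
have sig_rho : sig + s <= n%:R by rewrite /sig -addrA gerDl addrC subr_le0.
pose qm := Num.max 0 (Q - (h + h)).
have qm0 : 0 <= qm by rewrite le_max lexx.
(* The mixing error [e0] is also taken to be [h], which is why [Q] is perturbed by [h + h]. *)
have := lnZ_sandwich phi lam mphi phi0 phiN lam0 u Q h s u1 Q01 (ltW h0) s0 near_all
  n%:R sig sig0 sig_rho h qm h0 h1 qm0 (lexx _).
have := @mass_split R d s s0 n%:R sig sig0 sig_rho.
rewrite -boxLE !(lebd_cube (pt0 R d) sig)//=.
have volL : vol (@boxL R d n) = (2 * n%:R) ^+ d by rewrite boxLE vol_cube.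
have V0 : 0 < vol (@boxL R d n) by rewrite volL exprn_gt0// mulr_gt0.
have muL : fine (lebd d (@boxL R d n)) = vol (@boxL R d n).
  by rewrite volE// boxLE; exact: measurable_cube.
have sigE : (2 * sig) ^+ d = vol (@boxL R d n) * th.
  rewrite volL /th -exprMn; congr (_ ^+ d).
  by rewrite /x /sig; field; rewrite gt_eqF.
rewrite muL sigE => bE.
have -> : fine (lebd d (@boxL R d n `\` cube (pt0 R d) sig)) =
    vol (@boxL R d n) * (1 - th) by rewrite mulrBr mulr1; lra.
rewrite -/(Zr phi _) -/(cst_act lam _).
move: (Zr phi _) V0 => Z; move: (vol _) => V V0 /andP[lo up].
have up' : ln Z / V <= lam * (Q + 8 * h).
  rewrite ler_pdivrMr//; apply: (le_trans up).
  rewrite -mulrA -mulrA ler_pM2l//.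
  apply: (@le_trans _ _ (((Q + (h + h)) * th + (1 - th)) / (1 - h) * V)).
    by rewrite mulrC mulrAC ler_pM2r ?invr_gt0 ?subr_gt0//; lra.
  by rewrite ler_pM2r// squeeze_upper.
have lo' : lam * (Q - 8 * h) <= ln Z / V.
  rewrite ler_pdivlMr//; apply: le_trans lo.
  rewrite -mulrA -mulrA ler_pM2l//.
  apply: (@le_trans _ _ (qm * th / (1 + h) * V)).
    by rewrite ler_pM2r// squeeze_lower.
  have h1' : 0 < 1 + h by rewrite addr_gt0.
  by rewrite [leRHS]mulrC mulrAC ler_pM2r ?invr_gt0//; lra.
rewrite ler_norml; apply/andP; split; move: up' lo' he; rewrite !mulrBr !mulrDr; lra.
Qed.
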